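(* Let $m,n\ge 1$ be integers. Let $X$ be a normal hypersurface of bidegree $(1,1)$ in $\mathbf{P}^{m}\times\mathbf{P}^{n}$ over an algebraically closed field of characteristic zero, and let $f$ be its defining polynomial. Let $\lambda$ be a one-parameter subgroup of $\mathrm{SL}(m+1)\times\mathrm{SL}(n+1)$ which preserves $X$, and let $\alpha$ be the weight of $f$ for $\lambda$. For all positive integers $d$ and $e$, the Donaldson-Futaki invariant of the product test configuration $(\mathcal{X}_{\lambda},\mathcal{L}_{\lambda})$ for $(X,\mathcal{O}_{X}(d,e))$ induced by $\lambda$ is given by $$\mathrm{DF}(\mathcal{X}_{\lambda},\mathcal{L}_{\lambda})=-\frac{2mnde}{(me+nd)^{2}}\,\alpha .$$
   Context: We work over an algebraically closed field of characteristic zero. $\mathcal{O}_X(d,e)$ is the restriction to $X$ of $\mathcal{O}(d,e)$ on $\mathbf{P}^m\times\mathbf{P}^n$. Weight of $f$: $\mathrm{SL}(m+1)\times\mathrm{SL}(n+1)$ acts linearly on the homogeneous coordinate vectors $(x,y)=(x_0,\dots,x_m,y_0,\dots,y_n)$, and on bihomogeneous polynomials by the dual action $(g\cdot h)(x,y)=h(g^{-1}\cdot(x,y))$. Since $\lambda$ preserves $X$, $f$ is a semi-invariant of $\lambda$, and its weight $\alpha$ is the integer with $\lambda(t)\cdot f=t^{\alpha}f$, i.e. $f(\lambda(t)^{-1}\cdot(x,y))=t^{\alpha}f(x,y)$. Let $(X,L)$ be a polarized normal variety of dimension $N$. A test configuration $(\mathcal{X},\mathcal{L})$ for $(X,L)$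 consists of: a normal $\mathbf{G}_m$-variety $\mathcal{X}$; a $\mathbf{G}_m$-equivariant flat proper morphism $\pi\colon\mathcal{X}\to\mathbf{A}^1$, where $\mathbf{G}_m$ acts on $\mathbf{A}^1$ by the standard multiplication; a $\mathbf{G}_m$-linearized ample $\mathbf{Q}$-invertible sheaf $\mathcal{L}$ on $\mathcal{X}$; and an isomorphism $(\mathcal{X}_1,\mathcal{L}_1)\simeq(X,L)$, where the subscript $t$ denotes the fiber over $t\in\mathbf{A}^1$. Given a $\mathbf{G}_m$-action $\lambda$ on $X$, the induced product test configuration $(\mathcal{X}_\lambda,\mathcal{L}_\lambda)$ has $\mathcal{X}_\lambda=X\times\mathbf{A}^1$ with the diagonal $\mathbf{G}_m$-action (the product of $\lambda$ and the standard action on $\mathbf{A}^1$), and $\mathcal{L}_\lambda$ the pullback of $L$, linearized via a $\mathbf{G}_m$-linearization of some power of $L$. Its central fiber is $(X,L)$ with the action $\lambda$. For sufficiently divisible positive integers $k$, let $N_k=\dim H^0(\mathcal{X}_0,\mathcal{L}_0^{\otimes k})$ and let $w_k$ be the total weight (the sum of the weights, with multiplicity) of the dual action of $\mathbf{G}_m$ on $H^0(\mathcal{X}_0,\mathcal{L}_0^{\otimes k})$, i.e. the action on sections given by $(t\cdot s)(x)=t\cdot s(t^{-1}\cdot x)$; this is the same convention as for the action on polynomials above. There are expansions $$N_k=a_0k^{N}+a_1k^{N-1}+\cdots,\qquad w_k=b_0k^{N+1}+b_1k^{N}+\cdots .$$ The Donaldson-Futaki invariant is $$\mathrm{DF}(\mathcal{X},\mathcal{L})=2\,\frac{a_1b_0-a_0b_1}{a_0^2}.$$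 It is unchanged when the linearization on $\mathcal{L}$ is twisted by a character of $\mathbf{G}_m$, so it does not depend on the linearization chosen for $\mathcal{L}_\lambda$. *)

(* Defs.v *)
From HB Require Import structures.
From mathcomp Require Import all_boot all_order all_algebra.
From mathcomp Require Import mpoly.

Set Implicit Arguments.
Unset Strict Implicit.
Unset Printing Implicit Defensive.

Import GRing.Theory.

Local Open Scope ring_scope.

(* Closed subvarieties of P^m x P^n are handled through their bihomogeneous
   coordinates: a point is given by a pair of nonzero column vectors (x, y), and
   the variables of {mpoly R[m.+1 + n.+1]} are x_0, ..., x_m, y_0, ..., y_n. *)

Section Bihomogeneous.
Variables (R : nzRingType) (m n : nat).

Definition xdeg (mon : 'X_{1..m.+1 + n.+1}) : nat :=
  (\sum_(i < m.+1) mon (lshift n.+1 i))%N.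

Definition ydeg (mon : 'X_{1..m.+1 + n.+1}) : nat :=
  (\sum_(j < n.+1) mon (rshift m.+1 j))%N.

Definition bihomog (a b : nat) (p : {mpoly R[m.+1 + n.+1]}) : Prop :=
  forall mon, mon \in msupp p -> xdeg mon = a /\ ydeg mon = b.

Definition coord (x : 'cV[R]_m.+1) (y : 'cV[R]_n.+1) : 'I_(m.+1 + n.+1) -> R :=
  fun i => col_mx x y i ord0.

End Bihomogeneous.

Section Hypersurface.
Variables (K : fieldType) (m n : nat).
Local Notation S := {mpoly K[m.+1 + n.+1]}.
Implicit Types (f p q g h u v : S).

(* (x, y) are bihomogeneous coordinates of a point of the hypersurface f = 0. *)
Definition on_hypersurface f (x : 'cV[K]_m.+1) (y : 'cV[K]_n.+1) : Prop :=
  [/\ x != 0, y != 0 & f.@[coord x y] = 0].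

Definition in_ideal f p : Prop := exists c : S, p = c * f.

Definition prime_poly f : Prop :=
  [/\ f != 0, ~ in_ideal f 1
    & forall p q, in_ideal f (p * q) -> in_ideal f p \/ in_ideal f q].

(* When (f) is prime, the function field K(X) of X = {f = 0} consists of the
   fractions g / h of bihomogeneous elements of the same bidegree of S / (f), with
   h <> 0 in S / (f), and the local ring O_{X,(x,y)} of those fractions having a
   representative whose denominator does not vanish at (x, y).  The predicate
   below says that this local ring is integrally closed in K(X): the equation
     (g / h)^N + \sum_(l < N) (u_l / v) (g / h)^l = 0
   (finitely many elements of the local ring have a common denominator v) and the
   equality g / h = u / v are written modulo f, with denominators cleared. *)
Definition normal_at f (x : 'cV[K]_m.+1) (y : 'cV[K]_n.+1) : Prop :=
  forall (i j : nat) g h, bihomog i j g -> bihomog i j h -> ~ in_ideal f h ->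
    (exists (N i' j' : nat) (v : S) (u : 'I_N -> S),
      [/\ bihomog i' j' v, v.@[coord x y] != 0,
          forall l, bihomog i' j' (u l)
        & in_ideal f (v * g ^+ N + \sum_(l < N) u l * g ^+ l * h ^+ (N - l))]) ->
    exists (i' j' : nat) (u v : S),
      [/\ bihomog i' j' u, bihomog i' j' v, v.@[coord x y] != 0
        & in_ideal f (g * v - u * h)].

Definition normal_hypersurface f : Prop :=
  prime_poly f /\ forall x y, on_hypersurface f x y -> normal_at f x y.

End Hypersurface.

Section OneParameterSubgroup.
Variables (K : fieldType) (m n : nat).

(* The restriction of A to G_m = K \ {0} is a morphism of varieties, i.e. the
   entries of A t are Laurent polynomials in t. *)
Definition laurent_mx (k : nat) (A : K -> 'M[K]_k) : Prop :=
  exists (N : nat) (P : 'M[{poly K}]_k),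
    forall t, t != 0 -> A t = t ^- N *: map_mx (fun p : {poly K} => p.[t]) P.

(* Only the values at t != 0 are meaningful. *)
Record one_ps := OnePS {
  psx : K -> 'M[K]_m.+1;
  psy : K -> 'M[K]_n.+1;
  psx_laurent : laurent_mx psx;
  psy_laurent : laurent_mx psy;
  psx_det : forall t, t != 0 -> \det (psx t) = 1;
  psy_det : forall t, t != 0 -> \det (psy t) = 1;
  psxM : forall s t, s != 0 -> t != 0 -> psx (s * t) = psx s *m psx t;
  psyM : forall s t, s != 0 -> t != 0 -> psy (s * t) = psy s *m psy t
}.

Implicit Types (f : {mpoly K[m.+1 + n.+1]}) (lam : one_ps).

Definition preserves lam f : Prop :=
  forall t, t != 0 -> forall x y,
    on_hypersurface f x y -> on_hypersurface f (psx lam t *m x) (psy lam t *m y).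

Definition has_weight lam f (alpha : int) : Prop :=
  forall t, t != 0 -> forall x y,
    f.@[coord (invmx (psx lam t) *m x) (invmx (psy lam t) *m y)]
      = t ^ alpha * f.@[coord x y].

End OneParameterSubgroup.

(* Varieties in P^m x P^n x A^1: the third component is the coordinate on A^1,
   and {mpoly {poly K}[m.+1 + n.+1]} is K[tau][x, y]. *)

Section Families.
Variables (K : fieldType) (m n : nat).

Record point := Point { px : 'cV[K]_m.+1; py : 'cV[K]_n.+1; ptau : K }.

Definition eval (p : {mpoly {poly K}[m.+1 + n.+1]}) (P : point) : K :=
  p.@[fun i => (coord (px P) (py P) i)%:P].[ptau P].

(* For Z the set of coordinates of the points of a (reduced) locally closed
   subvariety of P^m x P^n x A^1, a section over Z of the pullback of O(a, b) is a
   function on Z which is locally, in the Zariski topology, a quotient p / q of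
   bihomogeneous polynomials whose bidegrees differ by (a, b).  Sections are only
   considered through their values on Z. *)
Definition regular_section (Z : point -> Prop) (a b : nat) (s : point -> K)
    : Prop :=
  forall P, Z P ->
    exists (i j : nat) (p q : {mpoly {poly K}[m.+1 + n.+1]}),
      [/\ bihomog (a + i) (b + j) p, bihomog i j q, eval q P != 0
        & forall Q, Z Q -> eval q Q != 0 -> s Q = eval p Q / eval q Q].

Section Spaces.
Variables (Z : point -> Prop) (V : (point -> K) -> Prop).

Definition basis_on (N : nat) (s : 'I_N -> point -> K) : Prop :=
  [/\ forall i, V (s i),
      forall c : 'I_N -> K,
        (forall P, Z P -> \sum_(i < N) c i * s i P = 0) -> forall i, c i = 0
    & forall s', V s' ->
        exists c : 'I_N -> K, forall P, Z P -> s' P = \sum_(i < N) c i * s i P].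

Definition has_dim (N : nat) : Prop := exists s : 'I_N -> point -> K, basis_on s.

(* w is the sum of the weights, with multiplicity, of the action act of G_m. *)
Definition has_total_weight (act : K -> (point -> K) -> point -> K) (w : int)
    : Prop :=
  exists (N : nat) (s : 'I_N -> point -> K) (wt : 'I_N -> int),
    [/\ basis_on s,
        forall i t, t != 0 -> forall P, Z P -> act t (s i) P = t ^ wt i * s i P
      & w = \sum_(i < N) wt i].

End Spaces.

(* The data of a polarized G_m-equivariant family embedded in P^m x P^n x A^1, with
   polarization O(fam_d, fam_e): fam_lin is a linearization of the power fam_r of
   the polarization, through which t acts on a section s of O(fam_d * k, fam_e * k)
   (fam_r dividing k) by
     (t . s)(P) = fam_lin t P ^ (k / fam_r) * s (t^-1 . P). *)
Record family := Family {
  fam_total : point -> Prop;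
  fam_act : K -> point -> point;
  fam_reldim : nat;
  fam_d : nat;
  fam_e : nat;
  fam_r : nat;
  fam_lin : K -> point -> K
}.

Definition central_fiber (T : family) : point -> Prop :=
  fun P => fam_total T P /\ ptau P = 0.

Definition H0_central (T : family) (k : nat) : (point -> K) -> Prop :=
  regular_section (central_fiber T) (fam_d T * k) (fam_e T * k).

Definition dual_act (T : family) (k : nat) (t : K) (s : point -> K) : point -> K :=
  fun P => fam_lin T t P ^+ (k %/ fam_r T) * s (fam_act T t^-1 P).

(* DF(T) = delta, for a family T with reduced central fiber.  A and B are the
   polynomials in k giving N_k and w_k for k sufficiently divisible; they are
   uniquely determined. *)
Definition DF_is (T : family) (delta : rat) : Prop :=
  exists (k0 : nat) (A B : {poly rat}),
    let N := fam_reldim T in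
    let a0 := A`_N in let a1 := A`_N.-1 in
    let b0 := B`_N.+1 in let b1 := B`_N in
    [/\ (0 < k0)%N /\ (fam_r T %| k0)%N,
        (size A <= N.+1)%N /\ (size B <= N.+2)%N,
        forall k : nat, (0 < k)%N -> (k0 %| k)%N ->
          exists (Nk : nat) (wk : int),
            [/\ has_dim (central_fiber T) (H0_central T k) Nk,
                has_total_weight (central_fiber T) (H0_central T k)
                  (dual_act T k) wk,
                Nk%:R = A.[k%:R]
              & wk%:~R = B.[k%:R]],
        a0 != 0
      & delta = 2 * ((a1 * b0 - a0 * b1) / a0 ^+ 2)].

End Families.

Section ProductFamily.
Variables (K : fieldType) (m n : nat).
Variables (f : {mpoly K[m.+1 + n.+1]}) (lam : one_ps K m n).

(* The linear action of lam on the coordinates makes t act on sections of O_X(a, b)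
   by s |-> s (lam(t)^-1 . ).  Any other linearization of the same sheaf differs
   from this one by an invertible regular function phi on G_m x X satisfying the
   cocycle condition, the action being (t . s)(P) = phi t P * s (lam(t)^-1 . P). *)
Definition linearization (phi : K -> 'cV[K]_m.+1 -> 'cV[K]_n.+1 -> K) : Prop :=
  [/\ regular_section
        (fun P => on_hypersurface f (px P) (py P) /\ ptau P != 0) 0 0
        (fun P => phi (ptau P) (px P) (py P)),
      forall x y, on_hypersurface f x y -> phi 1 x y = 1
    & forall s t, s != 0 -> t != 0 -> forall x y, on_hypersurface f x y ->
        phi (s * t) x y
          = phi s x y * phi t (invmx (psx lam s) *m x) (invmx (psy lam s) *m y)].

(* X x A^1 with the diagonal action, polarized by the pullback of O_X(d, e), whose
   r-th power is linearized through phi. *)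
Definition product_family (d e r : nat)
    (phi : K -> 'cV[K]_m.+1 -> 'cV[K]_n.+1 -> K) : family K m n :=
  {| fam_total := fun P => on_hypersurface f (px P) (py P);
     fam_act := fun t P =>
       Point (psx lam t *m px P) (psy lam t *m py P) (t * ptau P);
     fam_reldim := (m + n - 1)%N;
     fam_d := d;
     fam_e := e;
     fam_r := r;
     fam_lin := fun t P => phi t (px P) (py P) |}.

End ProductFamily.

(* Main.v *)
Require Import Defs.
From mathcomp Require Import all_boot all_order all_algebra.
From mathcomp Require Import perm mpoly.
From mathcomp Require Import ring zify.
Import GRing.Theory.
Local Open Scope ring_scope.

Set Implicit Arguments.
Unset Strict Implicit.
Unset Printing Implicit Defensive.

(* In coordinates xi, eta consisting of weight vectors of lambda, the equation f becomes
   xi_0 eta_0 + f'(xi', eta'), where f' involves only the other coordinates, and f' <> 0 because f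
   is prime.  A section of O_X(a, b) restricts to a polynomial along every rational curve of X,
   since a function of one variable that is locally a quotient of polynomials is globally one.
   Using the curves of the charts xi_0 <> 0 and eta_0 <> 0 it follows that the monomials of
   bidegree (a, b) not divisible by xi_0 eta_0 form a basis of H^0(X, O_X(a, b)); this replaces the
   vanishing of H^1(O(a - 1, b - 1)).  They are weight vectors, so N_k and w_k are differences of
   sums over the monomials of bidegrees (dk, ek) and (dk - 1, ek - 1).  The weights of all monomials
   of a given bidegree add up to 0, as lambda has determinant 1, and xi_0 eta_0 has weight alpha,
   so that w_k = - alpha h^0(O(dk - 1, ek - 1)), up to the twist by a character, which is the only
   freedom in the choice of a linearization. *)

(** * Rational functions of one variable *)

(** Sections are bare functions on coordinate vectors, given locally as quotients of polynomials, so
    all global information has to come from curves. The condition f' <> 0 is used twice: it provides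
    curves along which bil C u v is not identically zero, so that an identity known where x_0 y_0 <>
    0 spreads to the rest of X, and so that linear relations found where bil C u v <> 0 hold for all
    u, v. Characteristic zero enters through interpolation at 1, 2, ..., which writes coefficients
    as fixed combinations of values and thus transfers properties of a function to its coefficients.
    The constant of the result comes from the ratio of h^0(O(dk, ek)) to h^0(O(dk - 1, ek - 1)),
    which is (1 + m/(dk)) (1 + n/(ek)). If the second dimension is k^2 I(k), then N_k = (c1 k + c0)
    I(k) and, up to the twist, w_k = - alpha k^2 I(k), with c1 = m/d + n/e and c0 = mn/(de). This
    gives DF = - 2 alpha c0 / c1^2. *)

Section Univariate.
Variable K : closedFieldType.
Implicit Types (p q g h w : {poly K}).

Lemma poly_eq0_off_roots q p :
  q != 0 -> (forall t, q.[t] != 0 -> p.[t] = 0) -> p = 0.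
Proof.
move=> q0 H; apply/eqP/negP => /negP p0.
have /closed_nonrootP[t] : p * q != 0 by rewrite mulf_neq0.
rewrite rootM negb_or => /andP[/negP pt qt].
by apply: pt; apply/rootP/H; rewrite -rootE.
Qed.

Lemma poly_eq_off_roots w p q :
  w != 0 -> (forall t, w.[t] != 0 -> p.[t] = q.[t]) -> p = q.
Proof.
move=> w0 H; apply/eqP; rewrite -subr_eq0; apply/eqP.
by apply: (poly_eq0_off_roots w0) => t /H; rewrite hornerD hornerN => ->; rewrite subrr.
Qed.

Lemma poly_eq_off0 p q : (forall t, t != 0 -> p.[t] = q.[t]) -> p = q.
Proof.
move=> H; apply: (@poly_eq_off_roots 'X); first by rewrite polyX_eq0.
by move=> t; rewrite hornerX; apply: H.
Qed.

Lemma poly_ext p q : (forall t, p.[t] = q.[t]) -> p = q.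
Proof. by move=> H; apply: poly_eq_off0 => t _. Qed.

Lemma horner_coprime_neq0 p q t :
  coprimep p q -> q.[t] = 0 -> p.[t] != 0.
Proof.
by move=> cpq q0; rewrite -rootE; apply: (coprimep_root (p := q));
  rewrite 1?coprimep_sym // rootE q0.
Qed.

(* Two local expressions p/q, p1/q1 satisfy p q1 = p1 q as polynomials, so the
   reduced form of one of them has no pole where any of them is defined. *)
Lemma locally_rational_global w (c : K -> K) : w != 0 ->
  (forall t, w.[t] != 0 -> exists p q, q.[t] != 0 /\
     forall t', w.[t'] != 0 -> q.[t'] != 0 -> c t' = p.[t'] / q.[t']) ->
  exists p q, forall t, w.[t] != 0 -> q.[t] != 0 /\ c t = p.[t] / q.[t].
Proof.
move=> w0 H.
have [t0 /= wt0] : exists t, ~~ root w t by apply/closed_nonrootP.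
have [p [q [qt0 Hq]]] := H t0 wt0.
have q0 : q != 0 by apply: contraNneq qt0 => ->; rewrite horner0.
set g := gcdp p q.
have g0 : g != 0 by rewrite gcdp_eq0 negb_and q0 orbT.
pose p' := p %/ g; pose q' := q %/ g.
have Ep : p = p' * g by rewrite /p' divpK // dvdp_gcdl.
have Eq : q = q' * g by rewrite /q' divpK // dvdp_gcdr.
have cop : coprimep p' q' by apply: coprimep_div_gcd; rewrite q0 orbT.
exists p', q' => t wt.
have [p1 [q1 [q1t Hq1]]] := H t wt.
have q10 : q1 != 0 by apply: contraNneq q1t => ->; rewrite horner0.
have E : p' * q1 = p1 * q'.
  apply: (@poly_eq_off_roots (w * q * q1)); first by rewrite !mulf_neq0.
  move=> u; rewrite !hornerM !mulf_eq0 !negb_or -andbA => /and3P[wu qu q1u].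
  have := Hq1 u wu q1u; rewrite (Hq u wu qu) Ep Eq !hornerM.
  move: qu; rewrite Eq hornerM mulf_eq0 negb_or => /andP[q'u gu].
  rewrite -mulf_div divff // mulr1 => /eqP.
  by rewrite eqr_div // => /eqP.
have q't : q'.[t] != 0.
  apply/negP => /eqP q't; have /eqP := congr1 (horner^~ t) E.
  rewrite !hornerM q't mulr0 mulf_eq0 (negPf q1t) orbF.
  by rewrite (negPf (horner_coprime_neq0 cop q't)).
split=> //; rewrite (Hq1 t wt q1t); apply/eqP; rewrite eqr_div //.
by rewrite -!hornerM E.
Qed.

Lemma poly_no_root g : (forall t, g.[t] != 0) -> size g = 1.
Proof.
move=> H; apply/eqP/negPn/negP => /closed_rootP[t /rootP gt].
by have := H t; rewrite gt eqxx.
Qed.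

(** The global denominator has no root, so over an algebraically closed field it is a nonzero
    constant. *)
Lemma locally_rational_poly (c : K -> K) :
  (forall t, exists p q, q.[t] != 0 /\
     forall t', q.[t'] != 0 -> c t' = p.[t'] / q.[t']) ->
  exists g, forall t, c t = g.[t].
Proof.
move=> H; have [||p [q Hpq]] := @locally_rational_global 1 c.
- by rewrite oner_neq0.
- by move=> t _; have [p [q [? ?]]] := H t; exists p, q; split=> // t' _ qt'; auto.
have nz t : (1 : {poly K}).[t] != 0 by rewrite hornerE oner_neq0.
have /eqP/size_poly1P[d d0 Eq] : size q = 1 by apply: poly_no_root => t; case: (Hpq t (nz t)).
exists (d^-1 *: p) => t; have [_ ->] := Hpq t (nz t).
by rewrite Eq hornerC hornerZ mulrC.
Qed.

(** This describes the units of K[t, 1/t]; it serves for the numerator and the denominator of a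
    character of the multiplicative group. *)
Lemma poly_root_only0 g : g != 0 -> (forall t, t != 0 -> g.[t] != 0) ->
  exists k d, d != 0 /\ g = d *: 'X^k.
Proof.
move=> g0 H; have [k [q nq Eg]] := multiplicity_XsubC g 0.
move: nq Eg; rewrite g0 /= subr0 => nq Eg; exists k.
have /eqP/size_poly1P[d d0 Eq] : size q = 1.
  apply: poly_no_root => t; have [->|t0] := eqVneq t 0; first by rewrite -rootE.
  by have := H t t0; rewrite Eg hornerM mulf_eq0 negb_or => /andP[].
by exists d; split=> //; rewrite Eg Eq mul_polyC.
Qed.

(** The polynomial [h] is the expression near infinity of a function with a pole of order at most
    [d] there. Comparing [g] with the reversed polynomial [r], equal to t^D h(1/t), bounds the
    degree. *)
Lemma size_le_rev (d : nat) g h :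
  (forall t, t != 0 -> g.[t] = t ^+ d * h.[t^-1]) -> (size g <= d.+1)%N.
Proof.
move=> H; have [->|g0] := eqVneq g 0; first by rewrite size_poly0.
pose D := size h.
pose r := \poly_(i < D.+1) h`_(D - i).
have Er t : t != 0 -> r.[t] = t ^+ D * h.[t^-1].
  move=> t0; rewrite horner_poly (reindex_inj rev_ord_inj) /=.
  rewrite (horner_coef_wide _ (leqnSn D)) mulr_sumr; apply: eq_bigr => i _.
  rewrite subSS subKn; last by rewrite -ltnS.
  have iD : (i <= D)%N by rewrite -ltnS.
  have -> : t ^+ D = t ^+ (D - i) * t ^+ i by rewrite -exprD subnK.
  by rewrite exprVn; field; rewrite expf_neq0.
have E : g * 'X^D = r * 'X^d.
  by apply: poly_eq_off0 => t t0; rewrite !hornerM !hornerXn Er // H //; ring.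
have r0 : r != 0.
  by apply: contraNneq g0 => r0; move/eqP: E;
    rewrite r0 mul0r mulf_eq0 (negPf (monic_neq0 (monicXn _ _))) orbF.
have := congr1 (fun p => size p) E.
rewrite /= !size_mulXn // => Es.
have Hr : (size r <= D.+1)%N by apply: size_poly.
by rewrite -(leq_add2l D) Es addnC addnS -addSn leq_add2r.
Qed.

End Univariate.

(** * Monomials and homogeneous functions *)

Section Monomials.
Variable n : nat.

Definition mcons (k : nat) (m : 'X_{1..n}) : 'X_{1..n.+1} :=
  [multinom oapp m k (unlift ord0 i) | i < n.+1].

Definition mtail (m : 'X_{1..n.+1}) : 'X_{1..n} :=
  [multinom m (lift ord0 i) | i < n].

Lemma mcons0 k (m : 'X_{1..n}) : mcons k m ord0 = k.
Proof. by rewrite mnmE unlift_none. Qed.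

Lemma mconsS k (m : 'X_{1..n}) i : mcons k m (lift ord0 i) = m i.
Proof. by rewrite mnmE liftK. Qed.

Lemma mtailE (m : 'X_{1..n.+1}) i : mtail m i = m (lift ord0 i).
Proof. by rewrite mnmE. Qed.

Lemma mconsK (m : 'X_{1..n.+1}) : mcons (m ord0) (mtail m) = m.
Proof.
apply/mnmP => i; case: (unliftP ord0 i) => [j ->|->]; last by rewrite mcons0.
by rewrite mconsS mtailE.
Qed.

Lemma mtail_cons k m : mtail (mcons k m) = m.
Proof. by apply/mnmP => i; rewrite mtailE mconsS. Qed.

Lemma mdeg_cons k m : mdeg (mcons k m) = (k + mdeg m)%N.
Proof.
rewrite !mdegE big_ord_recl mcons0; congr addn.
by apply: eq_bigr => i _; rewrite mconsS.
Qed.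

End Monomials.

Definition monos (n d : nat) : seq 'X_{1..n} :=
  [seq s2m t | t : d.-tuple 'I_n <- enum (basis n d)].

Lemma mem_monos n d m : (m \in monos n d) = (mdeg m == d).
Proof. by rewrite -basis_cover. Qed.

Lemma monos_uniq n d : uniq (monos n d).
Proof. exact: uniq_basis. Qed.

Lemma size_monos n d : size (monos n.+1 d) = 'C(d + n, d).
Proof. exact: size_basis. Qed.

Lemma big_monos_recl (R : nmodType) n d (G : 'X_{1..n.+1} -> R) :
  \sum_(m <- monos n.+1 d) G m =
  \sum_(k < d.+1) \sum_(m <- monos n (d - k)) G (mcons k m).
Proof.
rewrite -(big_mkord predT (fun k => \sum_(m <- monos n (d - k)) G (mcons k m))).
rewrite -big_allpairs_dep; apply: perm_big; apply: uniq_perm.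
- exact: monos_uniq.
- apply: allpairs_uniq_dep => [|k _|]; rewrite ?iota_uniq ?monos_uniq //.
  move=> [k1 m1] [k2 m2] _ _ /= E.
  have E1 : k1 = k2 by have := congr1 (fun m : 'X_{1..n.+1} => m ord0) E; rewrite !mcons0.
  by subst; have := congr1 (@mtail n) E; rewrite !mtail_cons => ->.
move=> m; rewrite mem_monos; apply/eqP/allpairsPdep => [<-|[k [m' [kd m'd ->]]]].
  exists (m ord0), (mtail m); rewrite mem_index_iota mem_monos mconsK.
  by rewrite -[m in mdeg m]mconsK mdeg_cons ltnS leq_addr addKn.
by move: kd m'd; rewrite mem_index_iota mem_monos mdeg_cons => kd /eqP->; lia.
Qed.

Section Vectors.
Variables (R : nzRingType) (n : nat).

Definition vcons (c : R) (v : 'cV[R]_n) : 'cV[R]_n.+1 :=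
  \col_i oapp (fun j => v j ord0) c (unlift ord0 i).

Definition vtail (v : 'cV[R]_n.+1) : 'cV[R]_n := \col_i v (lift ord0 i) ord0.

Lemma vcons0 c v : vcons c v ord0 ord0 = c.
Proof. by rewrite mxE unlift_none. Qed.

Lemma vconsS c v i : vcons c v (lift ord0 i) ord0 = v i ord0.
Proof. by rewrite mxE liftK. Qed.

Lemma vtailE (v : 'cV[R]_n.+1) i : vtail v i ord0 = v (lift ord0 i) ord0.
Proof. by rewrite mxE. Qed.

Lemma vtail_cons c v : vtail (vcons c v) = v.
Proof. by apply/colP => i; rewrite vtailE vconsS. Qed.

Lemma vconsK (v : 'cV[R]_n.+1) : vcons (v ord0 ord0) (vtail v) = v.
Proof.
apply/colP => i; case: (unliftP ord0 i) => [j ->|->]; last by rewrite vcons0.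
by rewrite vconsS vtailE.
Qed.

Lemma vcons_eq0 c v : (vcons c v == 0) = (c == 0) && (v == 0).
Proof.
apply/eqP/andP => [E|[/eqP-> /eqP->]]; last first.
  by apply/colP => i; case: (unliftP ord0 i) => [j ->|->]; rewrite ?vcons0 ?vconsS !mxE.
split; apply/eqP; first by rewrite -(vcons0 c v) E mxE.
by apply/colP => i; rewrite -(vconsS c) E !mxE.
Qed.

Lemma vconsZ a c v : a *: vcons c v = vcons (a * c) (a *: v).
Proof.
apply/colP => i; rewrite mxE.
by case: (unliftP ord0 i) => [j ->|->]; rewrite ?vcons0 ?vconsS ?mxE.
Qed.

Lemma vconsD c d v w : vcons c v + vcons d w = vcons (c + d) (v + w).
Proof.
apply/colP => i; rewrite mxE.
by case: (unliftP ord0 i) => [j ->|->]; rewrite ?vcons0 ?vconsS ?mxE.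
Qed.

End Vectors.

Section MonomialFunctions.
Variables (R : comNzRingType) (n : nat).

Definition mono k (m : 'X_{1..k}) (v : 'cV[R]_k) : R := \prod_i v i ord0 ^+ m i.

Lemma mono_cons k m c (v : 'cV[R]_n) : mono (mcons k m) (vcons c v) = c ^+ k * mono m v.
Proof.
rewrite /mono big_ord_recl mcons0 vcons0; congr (_ * _).
by apply: eq_bigr => i _; rewrite mconsS vconsS.
Qed.

Lemma monoZ k (m : 'X_{1..k}) c (v : 'cV[R]_k) : mono m (c *: v) = c ^+ mdeg m * mono m v.
Proof.
rewrite /mono mdegE -prodrXr -big_split /=.
by apply: eq_bigr => i _; rewrite mxE exprMn.
Qed.

End MonomialFunctions.

Section HomogeneousFunctions.
Variable K : closedFieldType.
Hypothesis charK : [pchar K] =i pred0.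

Lemma natK_neq0 k : k.+1%:R != 0 :> K.
Proof. by have/pcharf0P-> := charK. Qed.

(** The nodes 1, ..., b + 1 are distinct and nonzero in characteristic zero, so their Vandermonde
    matrix is invertible. As [L] does not depend on [g], the coefficients of a polynomial depending
    on parameters inherit every property of its values that is stable under linear combinations. *)
Lemma interpolation b : exists L : 'I_b.+1 -> 'I_b.+1 -> K,
  forall g : {poly K}, (size g <= b.+1)%N ->
    forall k : 'I_b.+1, g`_k = \sum_l L k l * g.[(nat_of_ord l).+1%:R].
Proof.
pose V : 'M[K]_b.+1 := Vandermonde b.+1 (\row_j (nat_of_ord j).+1%:R).
have Vu : V \in unitmx.
  rewrite unitmxE det_Vandermonde unitfE; apply/prodf_neq0 => i _.
  apply/prodf_neq0 => j ij; rewrite !mxE -natrB ?ltnS 1?ltnW // subSS.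
  by have/pcharf0P-> := charK; rewrite subn_eq0 -ltnNge.
exists (fun k l => invmx V l k) => g sg k.
pose r : 'rV[K]_b.+1 := \row_i g`_i.
have -> : g`_k = r ord0 k by rewrite mxE.
rewrite -(mulmxK Vu r) mxE; apply: eq_bigr => l _; rewrite mulrC; congr (_ * _).
rewrite (horner_coef_wide _ sg) mxE; apply: eq_bigr => i _.
by rewrite !mxE.
Qed.

Definition homogeneous n (b : nat) (G : 'cV[K]_n -> K) :=
  forall c (v : 'cV[K]_n), c != 0 -> v != 0 -> G (c *: v) = c ^+ b * G v.

(** Only lines missing the origin are considered, since the value at 0 of a function of homogeneous
    coordinates is meaningless. *)
Definition linewise_poly n (G : 'cV[K]_n -> K) :=
  forall v w : 'cV[K]_n, (forall t, v + t *: w != 0) ->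
    exists g : {poly K}, forall t, G (v + t *: w) = g.[t].

(** Up to the factor t^b, exchanging [v] and [w] replaces t by 1/t; this controls the behaviour at
    infinity and bounds the degree. *)
Lemma homogeneous_linewise_size n b (G : 'cV[K]_n -> K) v w :
  homogeneous b G -> linewise_poly G ->
  (forall t, v + t *: w != 0) -> (forall t, w + t *: v != 0) ->
  exists2 g : {poly K}, (size g <= b.+1)%N & forall t, G (v + t *: w) = g.[t].
Proof.
move=> hG lG vw wv; have [g Hg] := lG v w vw; have [h Hh] := lG w v wv.
exists g => //; apply: (@size_le_rev _ _ _ h) => t t0.
rewrite -Hg -Hh -hG ?wv //; congr G.
by rewrite scalerDr scalerA divff // scale1r addrC.
Qed.

(* The coefficients lie in any space H of functions of y containing every F(-, v): this allows
   the two groups of variables of a bihomogeneous function to be treated one after the other. *)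
Lemma homogeneous_linewise_mono (Y : Type) (H : (Y -> K) -> Prop) n b (F : Y -> 'cV[K]_n.+1 ->
  K) :
  (forall N (c : 'I_N -> K) (h : 'I_N -> Y -> K), (forall i, H (h i)) ->
     H (fun y => \sum_i c i * h i y)) ->
  (forall v : 'cV[K]_n.+1, v != 0 -> H (F^~ v)) ->
  (forall y, homogeneous b (F y)) -> (forall y, linewise_poly (F y)) ->
  exists h : 'X_{1..n.+1} -> Y -> K, (forall m, H (h m)) /\
    forall y (v : 'cV[K]_n.+1), v != 0 -> F y v = \sum_(m <- monos n.+1 b) h m y * mono m v.
Proof.
move=> lcH; elim: n b F => [|n IHn] b F HF hF lF.
  exists (fun _ y => F y (const_mx 1)); split=> [_|y v v0].
    by apply: HF; apply/negP => /eqP/colP/(_ ord0)/eqP; rewrite !mxE oner_eq0.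
  have Ev : v = v ord0 ord0 *: const_mx 1.
    by apply/colP => i; rewrite !mxE mulr1 ord1.
  have v00 : v ord0 ord0 != 0 by apply: contraNneq v0 => E; rewrite Ev E scale0r.
  rewrite {1}Ev hF //; last first.
    by apply/negP => /eqP/colP/(_ ord0)/eqP; rewrite !mxE oner_eq0.
  rewrite (perm_big [:: [multinom b | _ < 1]]) /=; last first.
    apply: uniq_perm; rewrite ?monos_uniq // => m.
    rewrite mem_monos inE mdegE big_ord1; apply/eqP/eqP => [E|->]; last by rewrite mnmE.
    by apply/mnmP => i; rewrite ord1 E mnmE.
  by rewrite big_seq1 mulrC /mono big_ord1 mnmE.
have [L HL] := interpolation b.
(* This is the coefficient of c^k in F y (c, w), written through values so that it keeps the
   membership in [H] and the polynomiality along lines. *)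
pose g (k : 'I_b.+1) y w := \sum_l L k l * F y (vcons (nat_of_ord l).+1%:R w).
have vnz c (w : 'cV[K]_n.+1) : w != 0 -> vcons c w != 0.
  by rewrite vcons_eq0 negb_and => ->; rewrite orbT.
have Fline y (w : 'cV[K]_n.+1) : w != 0 -> exists2 p : {poly K}, (size p <= b.+1)%N &
    forall t, F y (vcons t w) = p.[t].
  move=> w0; have [||p sp Hp] := @homogeneous_linewise_size _ b (F y) (vcons 0 w) (vcons 1 0)
    (hF y) (lF y).
  - by move=> t; rewrite vconsZ vconsD scaler0 addr0 vnz.
  - move=> t; rewrite vconsZ vconsD mulr0 addr0 vcons_eq0 oner_eq0 //.
  exists p => // t; by rewrite -Hp vconsZ vconsD scaler0 addr0 mulr1 add0r.
have gE y (w : 'cV[K]_n.+1) c : w != 0 -> F y (vcons c w) = \sum_(k < b.+1) g k y w * c ^+ k.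
  move=> w0; have [p sp Hp] := Fline y w w0.
  rewrite Hp (horner_coef_wide _ sp); apply: eq_bigr => k _; congr (_ * _).
  by rewrite (HL _ sp); apply: eq_bigr => l _; rewrite Hp.
(* Compare the coefficients of t^k in F y (t, c w) = c^b F y (t / c, w). *)
have g_hom (k : 'I_b.+1) y : homogeneous (b - k) (g k y).
  move=> c w c0 w0.
  have cw0 : c *: w != 0 by rewrite scaler_eq0 negb_or c0.
  suff E : \poly_(i < b.+1) g (inord i) y (c *: w) =
           \poly_(i < b.+1) (c ^+ (b - i) * g (inord i) y w).
    by have := congr1 (fun p : {poly K} => p`_k) E; rewrite !coef_poly ltn_ord inord_val.
  apply: poly_ext => t; rewrite !horner_poly.
  under eq_bigr do rewrite inord_val.
  rewrite -gE // -{1}[t](mulfVK c0) [_ * c]mulrC -vconsZ hF ?vnz // gE // mulr_sumr.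
  apply: eq_bigr => i _; rewrite inord_val.
  have -> : c ^+ b = c ^+ (b - i) * c ^+ i by rewrite -exprD subnK // -ltnS.
  by rewrite exprMn exprVn; field; rewrite expf_neq0.
have g_lin (k : 'I_b.+1) y : linewise_poly (g k y).
  move=> v w vw.
  have /fin_all_exists[p Hp] : forall l : 'I_b.+1, exists p : {poly K}, forall t,
      F y (vcons (nat_of_ord l).+1%:R (v + t *: w)) = p.[t].
    move=> l; have [t|p Hp] := lF y (vcons (nat_of_ord l).+1%:R v) (vcons 0 w).
      by rewrite vconsZ vconsD vnz.
    by exists p => t; rewrite -Hp vconsZ vconsD mulr0 addr0.
  exists (\sum_l L k l *: p l) => t; rewrite /g horner_sum.
  by apply: eq_bigr => l _; rewrite hornerZ Hp.
have /fin_all_exists[h Hh] : forall k : 'I_b.+1, exists h : 'X_{1..n.+1} -> Y -> K,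
    (forall m, H (h m)) /\
    forall y (v : 'cV[K]_n.+1), v != 0 -> g k y v = \sum_(m <- monos n.+1 (b - k)) h m y * mono
      m v.
  move=> k; apply: IHn => // w w0; apply: lcH => l; exact/HF/vnz.
exists (fun m : 'X_{1..n.+2} => h (inord (m ord0)) (mtail m)); split=> [m|y v v0].
  by case: (Hh (inord (m ord0))).
have RHS_cons c w : \sum_(m <- monos n.+2 b) h (inord (m ord0)) (mtail m) y * mono m (vcons c w)
   = \sum_(k < b.+1) (\sum_(m <- monos n.+1 (b - k)) h k m y * mono m w) * c ^+ k.
  rewrite big_monos_recl; apply: eq_bigr => k _; rewrite mulr_suml.
  apply: eq_bigr => m _; rewrite mono_cons mcons0 inord_val mtail_cons; ring.
have main c (w : 'cV[K]_n.+1) : w != 0 -> F y (vcons c w) =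
    \sum_(m <- monos n.+2 b) h (inord (m ord0)) (mtail m) y * mono m (vcons c w).
  move=> w0; rewrite gE // RHS_cons; apply: eq_bigr => k _; congr (_ * _).
  by case: (Hh k) => _ ->.
rewrite -(vconsK v); set c := v _ _; set w := vtail v.
have [Ew|/main//] := eqVneq w 0.
have c0 : c != 0 by move: v0; rewrite -(vconsK v) -/w Ew vcons_eq0 eqxx andbT.
(* the line (c, t e) meets w = 0 only at t = 0 *)
pose e : 'cV[K]_n.+1 := const_mx 1.
have e0 : e != 0 by apply/negP => /eqP/colP/(_ ord0)/eqP; rewrite !mxE oner_eq0.
have [t|p Hp] := lF y (vcons c 0) (vcons 0 e).
  by rewrite vconsZ vconsD mulr0 addr0 vcons_eq0 negb_and c0.
have Hp' t : F y (vcons c (t *: e)) = p.[t].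
  by rewrite -Hp vconsZ vconsD mulr0 addr0 add0r.
pose q : {poly K} := \sum_(m <- monos n.+2 b)
   (h (inord (m ord0)) (mtail m) y * c ^+ (m ord0) * mono (mtail m) e) *: 'X^(mdeg (mtail m)).
have Hq t : q.[t] = \sum_(m <- monos n.+2 b) h (inord (m ord0)) (mtail m) y * mono m (vcons c (t
  *: e)).
  rewrite horner_sum; apply: eq_bigr => m _; rewrite hornerZ hornerXn.
  rewrite -[in mono m _](mconsK m) mono_cons monoZ; ring.
have E : p = q.
  apply: poly_eq_off0 => t t0; rewrite -Hp' Hq main //.
  by rewrite scaler_eq0 negb_or t0.
by rewrite Ew -[0 in LHS](scale0r e) Hp' E Hq scale0r.
Qed.

(** The one-vector lemma is applied in v, with [H] the space of forms of degree [a] in u; that F(-,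
    v) lies in [H] is the same lemma in u. The parameter u ranges over a subtype because nothing is
    known at u = 0. *)
Lemma homogeneous2_linewise_mono m n a b (F : 'cV[K]_m.+1 -> 'cV[K]_n.+1 -> K) :
  (forall u : 'cV[K]_m.+1, u != 0 -> homogeneous b (F u)) -> (forall u : 'cV[K]_m.+1, u != 0 ->
    linewise_poly (F u)) ->
  (forall v : 'cV[K]_n.+1, v != 0 -> homogeneous a (F^~ v)) ->
    (forall v : 'cV[K]_n.+1, v != 0 -> linewise_poly (F^~ v)) ->
  exists c : 'X_{1..m.+1} -> 'X_{1..n.+1} -> K,
    forall (u : 'cV[K]_m.+1) (v : 'cV[K]_n.+1), u != 0 -> v != 0 ->
    F u v = \sum_(mv <- monos n.+1 b) \sum_(mu <- monos m.+1 a) c mu mv * (mono mu u * mono mv v).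
Proof.
move=> hv lv hu lu.
pose H (h : {u : 'cV[K]_m.+1 | u != 0} -> K) :=
  exists c : 'X_{1..m.+1} -> K, forall u, h u = \sum_(mu <- monos m.+1 a) c mu * mono mu (val u).
have [||||h [Hh hE]] := @homogeneous_linewise_mono _ H n b (fun u v => F (val u) v).
- move=> N c h /fin_all_exists[d Hd]; exists (fun mu => \sum_i c i * d i mu) => u.
  under eq_bigr do rewrite Hd mulr_sumr.
  rewrite exchange_big; apply: eq_bigr => mu _; rewrite mulr_suml.
  by apply: eq_bigr => i _; rewrite mulrA.
- move=> v v0.
  have [||||d [_ Hd]] := @homogeneous_linewise_mono unit (fun _ => True) m a (fun _ u =>
    F u v) => //.
  + by move=> _; apply: hu.
  + by move=> _; apply: lu.
  by exists (d^~ tt) => -[u u0] /=; rewrite (Hd tt).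
- by case=> u u0; apply: hv.
- by case=> u u0; apply: lv.
suff [c Hc] : exists c : 'X_{1..m.+1} -> 'X_{1..n.+1} -> K, forall mv, mv \in monos n.+1 b ->
    forall u, h mv u = \sum_(mu <- monos m.+1 a) c mu mv * mono mu (val u).
  exists c => u v u0 v0; rewrite (hE (exist _ u u0)) // big_seq [RHS]big_seq.
  apply: eq_bigr => mv Hmv; rewrite Hc // mulr_suml; apply: eq_bigr => mu _.
  by rewrite mulrA.
(* The coefficients are chosen one monomial at a time along a finite list, which avoids a choice
   over all exponents. *)
elim: (monos n.+1 b) => [|mv s [c IH]]; first by exists (fun _ _ => 0).
have [d Hd] := Hh mv.
exists (fun mu mv' => if mv' == mv then d mu else c mu mv') => mv'; rewrite inE.
by case: eqVneq => [-> _|ne /= /IH].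
Qed.

End HomogeneousFunctions.

(** * Sections on x_0 y_0 + bil C x' y' = 0 *)

Section BilinearForm.
Variable R : comNzRingType.

Definition bil m n (C : 'M[R]_(m, n)) (u : 'cV[R]_m) (v : 'cV[R]_n) : R :=
  \sum_i \sum_j C i j * u i ord0 * v j ord0.

Lemma bilDl m n (C : 'M[R]_(m, n)) u u' v : bil C (u + u') v = bil C u v + bil C u' v.
Proof.
rewrite /bil -big_split; apply: eq_bigr => i _; rewrite -big_split.
by apply: eq_bigr => j _; rewrite /= mxE; ring.
Qed.

Lemma bilDr m n (C : 'M[R]_(m, n)) u v v' : bil C u (v + v') = bil C u v + bil C u v'.
Proof.
rewrite /bil -big_split; apply: eq_bigr => i _; rewrite -big_split.
by apply: eq_bigr => j _; rewrite /= mxE; ring.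
Qed.

Lemma bilZl m n (C : 'M[R]_(m, n)) c u v : bil C (c *: u) v = c * bil C u v.
Proof.
rewrite /bil mulr_sumr; apply: eq_bigr => i _; rewrite mulr_sumr.
by apply: eq_bigr => j _; rewrite mxE; ring.
Qed.

Lemma bilZr m n (C : 'M[R]_(m, n)) c u v : bil C u (c *: v) = c * bil C u v.
Proof.
rewrite /bil mulr_sumr; apply: eq_bigr => i _; rewrite mulr_sumr.
by apply: eq_bigr => j _; rewrite mxE; ring.
Qed.

Lemma bil0l m n (C : 'M[R]_(m, n)) v : bil C 0 v = 0.
Proof. by rewrite -(scale0r 0) bilZl mul0r. Qed.

Lemma bil0r m n (C : 'M[R]_(m, n)) u : bil C u 0 = 0.
Proof. by rewrite -(scale0r 0) bilZr mul0r. Qed.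

Lemma bil_tr m n (C : 'M[R]_(m, n)) u v : bil C^T v u = bil C u v.
Proof.
rewrite /bil exchange_big; apply: eq_bigr => i _.
by apply: eq_bigr => j _; rewrite mxE; ring.
Qed.

Lemma bil_delta m n (C : 'M[R]_(m, n)) i j : bil C (delta_mx i ord0) (delta_mx j ord0) = C i j.
Proof.
rewrite /bil (bigD1 i) //= (bigD1 j) //= !mxE !eqxx !mulr1 !big1 ?addr0 // =>
  [i' /negPf ne|j' /negPf ne].
  by rewrite big1 // => j' _; rewrite !mxE ne mulr0 mul0r.
by rewrite !mxE ne mulr0.
Qed.

End BilinearForm.

Section PolynomialCurves.
Variable K : closedFieldType.

Definition ev n (X : 'cV[{poly K}]_n) (t : K) : 'cV[K]_n := map_mx (horner^~ t) X.

Definition line n (v w : 'cV[K]_n) : 'cV[{poly K}]_n :=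
  map_mx polyC v + 'X *: map_mx polyC w.

Lemma ev_line n (v w : 'cV[K]_n) t : ev (line v w) t = v + t *: w.
Proof. by apply/colP => i; rewrite !mxE hornerD hornerM hornerX !hornerC. Qed.

Lemma ev_const n (v : 'cV[K]_n) t : ev (map_mx polyC v) t = v.
Proof. by apply/colP => i; rewrite !mxE hornerC. Qed.

Lemma evZ n p (X : 'cV[{poly K}]_n) t : ev (p *: X) t = p.[t] *: ev X t.
Proof. by apply/colP => i; rewrite !mxE hornerM. Qed.

Lemma ev_vcons n p (X : 'cV[{poly K}]_n) t : ev (vcons p X) t = vcons p.[t] (ev X t).
Proof.
by apply/colP => i; case: (unliftP ord0 i) => [j ->|->]; rewrite mxE ?vcons0 ?vconsS ?mxE.
Qed.

Lemma horner_bil m n (C : 'M[K]_(m, n)) X Y t :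
  (bil (map_mx polyC C) X Y).[t] = bil C (ev X t) (ev Y t).
Proof.
rewrite /bil horner_sum; apply: eq_bigr => i _; rewrite horner_sum.
by apply: eq_bigr => j _; rewrite !mxE !hornerM hornerC.
Qed.

(* Polynomial maps, in the only form in which they are used: by their restriction to
   polynomial curves. *)
Definition curvewise_poly m n (p : 'cV[K]_m -> 'cV[K]_n -> K) : Prop :=
  forall X Y, exists g : {poly K}, forall t, p (ev X t) (ev Y t) = g.[t].

Lemma curvewise_poly_mono m n (mu : 'X_{1..m}) (mv : 'X_{1..n}) :
  curvewise_poly (fun x y => mono mu x * mono mv y : K).
Proof.
move=> X Y; exists (mono mu X * mono mv Y) => t; rewrite hornerM /mono !horner_prod.
by congr (_ * _); apply: eq_bigr => i _; rewrite mxE horner_exp.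
Qed.

Lemma curvewise_poly_sum (I : Type) (r : seq I) (c : I -> K) m n (p : I -> 'cV[K]_m ->
  'cV[K]_n -> K) :
  (forall i, curvewise_poly (p i)) -> curvewise_poly (fun x y => \sum_(i <- r) c i * p i x y).
Proof.
move=> H X Y; elim: r => [|i r [g Hg]].
  by exists 0 => t; rewrite big_nil horner0.
have [h Hh] := H i X Y; exists (c i *: h + g) => t.
by rewrite big_cons Hg Hh hornerD hornerZ.
Qed.

End PolynomialCurves.

Section Sections.
Variable K : closedFieldType.
Hypothesis charK : [pchar K] =i pred0.

Definition on_quadric m n (C : 'M[K]_(m, n)) (x : 'cV[K]_m.+1) (y : 'cV[K]_n.+1) : Prop :=
  [/\ x != 0, y != 0 & x ord0 ord0 * y ord0 ord0 + bil C (vtail x) (vtail y) = 0].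

Lemma on_quadric_cons m n (C : 'M[K]_(m, n)) (c d : K) u v :
  on_quadric C (vcons c u) (vcons d v) <->
  [/\ (c != 0) || (u != 0), (d != 0) || (v != 0) & c * d + bil C u v = 0].
Proof. by rewrite /on_quadric !vcons_eq0 !negb_and !vcons0 !vtail_cons. Qed.

(** Sections of O(a, b) are encoded as functions of bidegree (a, b) on the affine cone. The local
    numerators and denominators need only be polynomial along curves, a condition stable under
    linear changes of coordinates. *)
Definition is_section m n (Z : 'cV[K]_m -> 'cV[K]_n -> Prop) a b (s : 'cV[K]_m -> 'cV[K]_n ->
  K) : Prop :=
  [/\ forall (c : K) x y, c != 0 -> Z x y -> s (c *: x) y = c ^+ a * s x y,
      forall (c : K) x y, c != 0 -> Z x y -> s x (c *: y) = c ^+ b * s x y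
    & forall x y, Z x y -> exists p q, [/\ curvewise_poly p, curvewise_poly q, q x y != 0
        & forall x' y', Z x' y' -> q x' y' != 0 -> s x' y' = p x' y' / q x' y']].

Lemma is_section_swap m n (Z : 'cV[K]_m -> 'cV[K]_n -> Prop) (Z' : 'cV[K]_n -> 'cV[K]_m ->
  Prop) a b s :
  (forall x y, Z x y <-> Z' y x) ->
  is_section Z a b s -> is_section Z' b a (fun y x => s x y).
Proof.
move=> ZZ' [hx hy loc]; split=> [c y x c0 /ZZ' /hy->|c y x c0 /ZZ' /hx->|y x /ZZ'/loc] //.
move=> [p [q [cp cq qxy Hpq]]]; exists (fun y x => p x y), (fun y x => q x y); split=> //.
by move=> y' x' /ZZ'; apply: Hpq.
Qed.

Lemma section_on_curve m n (Z : 'cV[K]_m -> 'cV[K]_n -> Prop) a b s X Y :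
  is_section Z a b s -> (forall t, Z (ev X t) (ev Y t)) ->
  exists g : {poly K}, forall t, s (ev X t) (ev Y t) = g.[t].
Proof.
move=> [_ _ loc] ZXY; apply: locally_rational_poly => t.
have [p [q [cp cq qxy Hpq]]] := loc _ _ (ZXY t).
have [P HP] := cp X Y; have [Q HQ] := cq X Y.
exists P, Q; rewrite -HQ; split=> // t'; rewrite -HQ -HP; exact: Hpq.
Qed.

(** Near [t0] the section is P/Q with Q nonzero at [t0]; agreement off the roots of [r * Q] forces P
    = F Q as polynomials in t, hence agreement at [t0]. The curve itself may leave [Z] at the roots
    of [r]. *)
Lemma section_extend m n (Z : 'cV[K]_m -> 'cV[K]_n -> Prop) a b s Phi (r : {poly K}) X Y t0 :
  is_section Z a b s -> curvewise_poly Phi -> r != 0 ->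
  (forall t, r.[t] != 0 -> Z (ev X t) (ev Y t) /\ s (ev X t) (ev Y t) = Phi (ev X t) (ev Y t)) ->
  Z (ev X t0) (ev Y t0) -> s (ev X t0) (ev Y t0) = Phi (ev X t0) (ev Y t0).
Proof.
move=> [_ _ loc] cPhi r0 H Z0.
have [p [q [cp cq qxy Hpq]]] := loc _ _ Z0.
have [P HP] := cp X Y; have [Q HQ] := cq X Y; have [F HF] := cPhi X Y.
have Qt0 : Q.[t0] != 0 by rewrite -HQ.
have Q0 : Q != 0 by apply: contraNneq Qt0 => ->; rewrite horner0.
have E : P = F * Q.
  apply: (@poly_eq_off_roots _ (r * Q)); first by rewrite mulf_neq0.
  move=> t; rewrite !hornerM mulf_eq0 negb_or => /andP[/H[Zt sF] Qt].
  by rewrite -HF -sF Hpq ?HQ // HP mulfVK.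
by rewrite Hpq // HP HQ E hornerM mulfK // HF.
Qed.

Section Quadric.
Variables (m n : nat) (C : 'M[K]_(m.+1, n.+1)).
Local Notation Z := (on_quadric C).

Lemma on_quadric_chart (c : K) u (v : 'cV[K]_n.+1) : c != 0 -> v != 0 ->
  Z (vcons c u) (vcons (- bil C u v) (c *: v)).
Proof.
move=> c0 v0; apply/on_quadric_cons; rewrite c0 scaler_eq0 negb_or c0 v0 orbT; split=> //.
by rewrite bilZr; ring.
Qed.

Variables (a b : nat) (s : 'cV[K]_m.+2 -> 'cV[K]_n.+2 -> K).
Hypothesis sec : is_section Z a b s.

(* With x = (c, u), the equation gives y_0 = - bil C u v / c; y is rescaled by c so that the
   values are polynomial in c. *)
Definition chart c u v : K := s (vcons c u) (vcons (- bil C u v) (c *: v)).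

(** Dividing both vectors by c and setting t = 1/c gives the curve ((1, t u), (- t bil C u v, v)),
    which extends to t = 0. The factor c^(a + b) produced by the two divisions bounds the degree. *)
Lemma chart_poly (u : 'cV[K]_m.+1) (v : 'cV[K]_n.+1) : u != 0 -> v != 0 ->
  exists2 g : {poly K}, (size g <= (a + b).+1)%N & forall c, c != 0 -> chart c u v = g.[c].
Proof.
move=> u0 v0; have [hx hy _] := sec.
have [|h Hh] := @section_on_curve _ _ _ _ _ _ (vcons 1 ('X *: map_mx polyC u))
   (vcons (- (bil C u v) *: 'X) (map_mx polyC v)) sec.
  move=> t; rewrite !ev_vcons !evZ !ev_const hornerC hornerZ hornerX.
  apply/on_quadric_cons; rewrite oner_eq0 v0 orbT; split=> //.
  by rewrite bilZl; ring.
have {Hh}Hh t : s (vcons 1 (t *: u)) (vcons (- bil C u v * t) v) = h.[t].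
  by rewrite -Hh !ev_vcons !evZ !ev_const hornerC hornerZ hornerX.
have rev c : c != 0 -> chart c u v = c ^+ (a + b) * h.[c^-1].
  move=> c0; rewrite -Hh exprD -mulrA.
  have Z1 : Z (vcons 1 (c^-1 *: u)) (vcons (- bil C u v * c^-1) v).
    apply/on_quadric_cons; rewrite oner_eq0 v0 orbT; split=> //.
    by rewrite bilZl; ring.
  have cv0 : c *: v != 0 by rewrite scaler_eq0 negb_or c0.
  have Z2 : Z (vcons 1 (c^-1 *: u)) (c *: vcons (- bil C u v * c^-1) v).
    rewrite vconsZ; apply/on_quadric_cons; rewrite oner_eq0 cv0 orbT; split=> //.
    by rewrite bilZl bilZr; field.
  rewrite -hy // -hx // /chart !vconsZ !scalerA divff // scale1r mulr1.
  by congr (s _ (vcons _ _)); field.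
suff [g Hg] : exists g : {poly K}, forall c, c != 0 -> chart c u v = g.[c].
  exists g => //; apply: (@size_le_rev _ _ _ h) => t t0.
  by rewrite -Hg // rev.
(* At c = 0 the second vector becomes (- bil C u v, 0), which is admissible only if bil C u v <> 0.
   Otherwise it is c (0, v), and the scalar comes out as c^b. *)
have [B0|B0] := eqVneq (bil C u v) 0; last first.
  have [|g Hg] := @section_on_curve _ _ _ _ _ _ (vcons 'X (map_mx polyC u))
     (vcons (- (bil C u v))%:P ('X *: map_mx polyC v)) sec.
    move=> t; rewrite !ev_vcons !evZ !ev_const hornerC hornerX.
    apply/on_quadric_cons; rewrite u0 oppr_eq0 B0 orbT; split=> //.
    by rewrite bilZr; ring.
  by exists g => c c0; rewrite -Hg !ev_vcons !evZ !ev_const hornerC hornerX.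
have [|g Hg] := @section_on_curve _ _ _ _ _ _ (vcons 'X (map_mx polyC u))
     (map_mx polyC (vcons 0 v)) sec.
  move=> t; rewrite !ev_vcons !ev_const hornerX.
  by apply/on_quadric_cons; rewrite u0 v0 !orbT mulr0 B0 addr0.
exists ('X^b * g) => c c0; rewrite hornerM hornerXn -Hg !ev_vcons !ev_const hornerX.
rewrite -hy //; last by apply/on_quadric_cons; rewrite u0 v0 !orbT mulr0 B0 addr0.
by rewrite /chart B0 oppr0 vconsZ mulr0.
Qed.

(* The coefficients sg k are bihomogeneous, of bidegree (a + b - k, b), because distinct powers
   of c separate the weights of the torus preserving x_0 y_0. *)
Lemma chart_coefs : exists sg : 'I_(a + b).+1 -> 'cV[K]_m.+1 -> 'cV[K]_n.+1 -> K,
  (forall (c : K) (u : 'cV[K]_m.+1) (v : 'cV[K]_n.+1), c != 0 -> u != 0 -> v != 0 ->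
    chart c u v = \sum_k sg k u v * c ^+ k) /\
  forall k : 'I_(a + b).+1, exists d : 'X_{1..m.+1} -> 'X_{1..n.+1} -> K,
    forall (u : 'cV[K]_m.+1) (v : 'cV[K]_n.+1), u != 0 -> v != 0 ->
    sg k u v = \sum_(mv <- monos n.+1 b) \sum_(mu <- monos m.+1 (a + b - k)) d mu mv * (mono mu
      u * mono mv v).
Proof.
have [hx hy _] := sec.
have [L HL] := interpolation charK (a + b).
pose z (l : 'I_(a + b).+1) : K := l.+1%:R.
have z0 l : z l != 0 by apply: natK_neq0.
exists (fun k u v => \sum_l L k l * chart (z l) u v).
have sgE c (u : 'cV[K]_m.+1) (v : 'cV[K]_n.+1) : c != 0 -> u != 0 -> v != 0 ->
  chart c u v = \sum_k (\sum_l L k l * chart (z l) u v) * c ^+ k.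
  move=> c0 u0 v0; have [g sg Hg] := chart_poly u0 v0.
  rewrite Hg // (horner_coef_wide _ sg); apply: eq_bigr => k _; congr (_ * _).
  by rewrite (HL _ sg); apply: eq_bigr => l _; rewrite Hg.
split=> // k.
apply: (homogeneous2_linewise_mono charK) =>
  [u u0 c v c0 v0|u u0 v w vw|v v0 c u c0 u0|v v0 u w uw].
- rewrite mulr_sumr; apply: eq_bigr => l _; rewrite mulrCA; congr (_ * _).
  rewrite -hy //; last exact: on_quadric_chart.
  by rewrite /chart vconsZ bilZr !scalerA [c * z l]mulrC mulrN.
- have /fin_all_exists[p Hp] : forall l, exists p : {poly K}, forall t,
      chart (z l) u (v + t *: w) = p.[t].
    move=> l; have [|p Hp] := @section_on_curve _ _ _ _ _ _ (map_mx polyC (vcons (z l) u))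
     (vcons (- bil (map_mx polyC C) (map_mx polyC u) (line v w)) ((z l)%:P *: line v w)) sec.
      move=> t; rewrite ev_const ev_vcons evZ hornerN horner_bil ev_const hornerC ev_line.
      exact: on_quadric_chart.
    by exists p => t; rewrite -Hp ev_const ev_vcons evZ hornerN horner_bil ev_const hornerC
      ev_line.
  exists (\sum_l L k l *: p l) => t; rewrite horner_sum.
  by apply: eq_bigr => l _; rewrite hornerZ Hp.
- suff E : \poly_(i < (a + b).+1) (\sum_l L (inord i) l * chart (z l) (c *: u) v) =
           \poly_(i < (a + b).+1) (c ^+ (a + b - i) * \sum_l L (inord i) l * chart (z l) u v).
    by have := congr1 (fun p : {poly K} => p`_k) E; rewrite !coef_poly ltn_ord inord_val.
  apply: poly_eq_off0 => t t0; rewrite !horner_poly.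
  under eq_bigr do rewrite inord_val.
  rewrite -sgE ?scaler_eq0 ?negb_or ?c0 //.
  have tc0 : t / c != 0 by rewrite mulf_neq0 ?invr_eq0.
  (* Both vectors in [chart t (c *: u) v] are c times those in [chart (t / c) u v]; the powers of t
     then separate the degrees in u. *)
  transitivity (c ^+ (a + b) * chart (t / c) u v).
    have Z1 := on_quadric_chart u tc0 v0.
    have Z2 : Z (vcons (t / c) u) (c *: vcons (- bil C u v) ((t / c) *: v)).
      rewrite vconsZ; apply/on_quadric_cons; rewrite tc0 !scaler_eq0 !negb_or c0 tc0 v0 orbT;
        split=> //.
      by rewrite !bilZr; ring.
    rewrite exprD -mulrA -hy // -hx // /chart !vconsZ !scalerA bilZl.
    by congr (s (vcons _ _) (vcons _ (_ *: _))); field.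
  rewrite sgE // mulr_sumr; apply: eq_bigr => i _; rewrite inord_val.
  have -> : c ^+ (a + b) = c ^+ (a + b - i) * c ^+ i by rewrite -exprD subnK // -ltnS.
  by rewrite exprMn exprVn; field; rewrite expf_neq0.
have /fin_all_exists[p Hp] : forall l, exists p : {poly K}, forall t,
    chart (z l) (u + t *: w) v = p.[t].
  move=> l; have [|p Hp] := @section_on_curve _ _ _ _ _ _ (vcons (z l)%:P (line u w))
   (vcons (- bil (map_mx polyC C) (line u w) (map_mx polyC v)) ((z l)%:P *: map_mx polyC v)) sec.
    move=> t; rewrite !ev_vcons evZ hornerN horner_bil ev_const hornerC ev_line.
    exact: on_quadric_chart.
  by exists p => t; rewrite -Hp !ev_vcons evZ hornerN horner_bil ev_const hornerC ev_line.
exists (\sum_l L k l *: p l) => t; rewrite horner_sum.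
by apply: eq_bigr => l _; rewrite hornerZ Hp.
Qed.

(** A point with x_0 <> 0 and y_0 = 0 is joined to points with y_0 <> 0 by moving x' and y' freely
    along two coordinate vectors and solving for y_0. With [C i j] nonzero, the resulting y_0 has a
    nonzero coefficient of t^2, so it is not identically zero. *)
Lemma section_extend_x0 Phi :
  C != 0 -> curvewise_poly Phi ->
  (forall x y, Z x y -> x ord0 ord0 != 0 -> y ord0 ord0 != 0 -> s x y = Phi x y) ->
  forall x y, Z x y -> x ord0 ord0 != 0 -> s x y = Phi x y.
Proof.
move=> C0 cPhi H x y Zxy; rewrite -(vconsK x) -(vconsK y) in Zxy *.
move: (x _ _) (vtail x) (y _ _) (vtail y) Zxy => {x y} c u d v.
rewrite vcons0 => Zxy c0; have /on_quadric_cons[_ dv0 E] := Zxy.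
have /matrix0Pn[i [j Cij]] := C0.
pose u1 : 'cV[K]_m.+1 := delta_mx i ord0; pose w : 'cV[K]_n.+1 := delta_mx j ord0.
pose r := (- c^-1) *: bil (map_mx polyC C) (line u u1) (line v w).
have rE t : r.[t] = - c^-1 * (bil C u v + t * (bil C u1 v + bil C u w) + t ^+ 2 * C i j).
  rewrite hornerZ horner_bil !ev_line bilDl !bilDr !bilZl !bilZr.
  rewrite (_ : bil C u1 w = C i j) ?bil_delta //.
  by congr (_ * _); ring.
have rP : r = (- c^-1) *: ((bil C u v)%:P + (bil C u1 v + bil C u w) *: 'X + C i j *: 'X^2).
  by apply: poly_ext => t; rewrite rE hornerZ !hornerD hornerC !hornerZ hornerX hornerXn;
    congr (_ * _); ring.
have r0 : r != 0.
  apply/negP => /eqP/(congr1 (fun p : {poly K} => p`_2))/eqP.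
  rewrite rP coefZ !coefD coefC !coefZ coefX coefXn coef0 /= mulr0 !add0r mulr1.
  by rewrite mulf_eq0 oppr_eq0 invr_eq0 (negPf c0) (negPf Cij).
pose X := vcons c%:P (line u u1); pose Y := vcons r (line v w).
have EX t : ev X t = vcons c (u + t *: u1) by rewrite ev_vcons hornerC ev_line.
have EY t : ev Y t = vcons r.[t] (v + t *: w) by rewrite ev_vcons ev_line.
have X0 : ev X 0 = vcons c u by rewrite EX scale0r addr0.
have Y0 : ev Y 0 = vcons d v.
  rewrite EY scale0r addr0 rE; congr vcons; rewrite !mul0r !addr0 expr0n mul0r addr0.
  by move/eqP: E; rewrite addrC addr_eq0 => /eqP->; field.
rewrite -X0 -Y0; apply: (section_extend sec cPhi r0); last by rewrite X0 Y0.
move=> t rt; have Zt : Z (ev X t) (ev Y t).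
  rewrite EX EY; apply/on_quadric_cons; rewrite c0 rt; split=> //.
  by rewrite hornerZ horner_bil !ev_line; field.
by split=> //; apply: H => //; rewrite ?EX ?EY vcons0.
Qed.

End Quadric.
End Sections.

(** * Normal monomials *)

Section Spanning.
Variable K : closedFieldType.
Hypothesis charK : [pchar K] =i pred0.

(* The monomials not divisible by x_0 y_0: representatives of the monomials of bidegree (a, b)
   modulo x_0 y_0 + bil C x' y'. *)
Definition normal_monos m n a b : seq ('X_{1..m.+1} * 'X_{1..n.+1}) :=
  [seq p : 'X_{1..m.+1} * 'X_{1..n.+1} <- [seq (mu, mv) | mu <- monos m.+1 a, mv <- monos n.+1 b]
     | (p.1 ord0 == 0%N) || (p.2 ord0 == 0%N)].

Lemma mem_normal_monos m n a b (p : 'X_{1..m.+1} * 'X_{1..n.+1}) :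
  (p \in normal_monos m n a b) =
  [&& (p.1 ord0 == 0%N) || (p.2 ord0 == 0%N), mdeg p.1 == a & mdeg p.2 == b].
Proof.
rewrite mem_filter; congr (_ && _).
apply/allpairsP/andP => [[[mu mv] /= [Hu Hv ->]]|[pa pb]].
  by rewrite -!mem_monos.
by exists p; rewrite !mem_monos -surjective_pairing.
Qed.

Lemma normal_monos_uniq m n a b : uniq (normal_monos m n a b).
Proof.
apply/filter_uniq/allpairs_uniq; rewrite ?monos_uniq //.
by move=> [? ?] [? ?].
Qed.

Definition bimono m n (p : 'X_{1..m} * 'X_{1..n}) (x : 'cV[K]_m) (y : 'cV[K]_n) : K :=
  mono p.1 x * mono p.2 y.

Section NormalSpan.
Variables (m n a b : nat).

Definition normal_span (Phi : 'cV[K]_m.+1 -> 'cV[K]_n.+1 -> K) : Prop :=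
  exists c, forall x y, Phi x y = \sum_(p <- normal_monos m n a b) c p * bimono p x y.

Lemma normal_span_sum (I : Type) (r : seq I) (Phi : I -> 'cV[K]_m.+1 -> 'cV[K]_n.+1 ->
  K) (P : pred I) :
  (forall i, P i -> normal_span (Phi i)) -> normal_span (fun x y =>
    \sum_(i <- r | P i) Phi i x y).
Proof.
move=> H; elim: r => [|i r [c Hc]].
  by exists (fun _ => 0) => x y; rewrite big_nil big1 // => p _; rewrite mul0r.
case Pi: (P i); last by exists c => x y; rewrite big_cons Pi Hc.
have [d Hd] := H i Pi; exists (fun p => d p + c p) => x y.
rewrite big_cons Pi Hc Hd -big_split; apply: eq_bigr => p _.
by rewrite mulrDl.
Qed.

Lemma normal_spanZ c Phi : normal_span Phi -> normal_span (fun x y => c * Phi x y).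
Proof.
move=> [d Hd]; exists (fun p => c * d p) => x y.
by rewrite Hd mulr_sumr; apply: eq_bigr => p _; rewrite mulrA.
Qed.

Lemma normal_span_mono p Phi : p \in normal_monos m n a b ->
  (forall x y, Phi x y = bimono p x y) -> normal_span Phi.
Proof.
move=> Hp E; exists (fun q => (q == p)%:R) => x y; rewrite E.
rewrite (bigD1_seq p) ?normal_monos_uniq //= eqxx mul1r big1 ?addr0 // => q /negPf->.
by rewrite mul0r.
Qed.

Lemma normal_span_curvewise Phi : normal_span Phi -> curvewise_poly Phi.
Proof.
move=> [c Hc] X Y; have [g Hg] := @curvewise_poly_sum K _ (normal_monos m n a b) c _ _
  (fun p x y => bimono p x y) (fun p => curvewise_poly_mono p.1 p.2) X Y.
by exists g => t; rewrite Hc Hg.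
Qed.

End NormalSpan.

Lemma on_quadric_swap m n (C : 'M[K]_(m, n)) x y : on_quadric C x y <-> on_quadric C^T y x.
Proof. by split=> -[? ? E]; split=> //; move: E; rewrite bil_tr mulrC. Qed.

(* Comparison of the charts x_0 <> 0 and y_0 <> 0: a negative power of x_0 is traded for a
   positive power of y_0. *)
Lemma chart_coefs_swap m n (C : 'M[K]_(m.+1, n.+1)) a b s
    (sg : 'I_(a + b).+1 -> _) (sg' : 'I_(b + a).+1 -> _) :
  is_section (on_quadric C) a b s ->
  (forall (c : K) (u : 'cV[K]_m.+1) (v : 'cV[K]_n.+1), c != 0 -> u != 0 -> v != 0 ->
     chart C s c u v = \sum_k sg k u v * c ^+ k) ->
  (forall (c : K) (v : 'cV[K]_n.+1) (u : 'cV[K]_m.+1), c != 0 -> v != 0 -> u != 0 ->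
     chart C^T (fun y x => s x y) c v u = \sum_k sg' k v u * c ^+ k) ->
  forall (k : 'I_(a + b).+1) (u : 'cV[K]_m.+1) (v : 'cV[K]_n.+1), bil C u v != 0 -> (k < b)%N ->
  sg k u v = sg' (inord (a + b - k)) v u * (- bil C u v) ^+ (b - k).
Proof.
move=> sec Hsg Hsg' k u v B0 kb; have [hx hy _] := sec.
have u0 : u != 0 by apply: contraNneq B0 => ->; rewrite bil0l.
have v0 : v != 0 by apply: contraNneq B0 => ->; rewrite bil0r.
set B := - bil C u v; have {}B0 : B != 0 by rewrite oppr_eq0.
(* The same point of the variety seen in both charts: ((B, (B/c) u), (B/c, v)) is obtained from ((c,
   u), (B, c v)) by the scalars B/c and 1/c. *)
have E c : c != 0 -> chart C^T (fun y x => s x y) (B / c) v u = (B / c) ^+ a * (c ^- b * chart C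
  s c u v).
  move=> c0; have e0 : B / c != 0 by rewrite mulf_neq0 ?invr_eq0.
  have Z1 := on_quadric_chart C u c0 v0.
  have Z2 : on_quadric C (vcons c u) (c^-1 *: vcons (- bil C u v) (c *: v)).
    rewrite vconsZ scalerA mulVf // scale1r; apply/on_quadric_cons; rewrite c0 v0 orbT;
      split=> //.
    by field.
  rewrite -exprVn -hy ?invr_eq0 // -hx // /chart bil_tr !vconsZ scalerA mulVf // scale1r mulfVK
    //.
  by rewrite [c^-1 * _]mulrC.
(* After multiplication by c^(a + b) the second chart is read backwards, because its parameter B/c
   is inverse to c; hence the indices a + b - i. *)
suff P : \poly_(i < (a + b).+1) (sg' (inord (a + b - i)) v u * B ^+ (a + b - i)) =
         \poly_(i < (a + b).+1) (B ^+ a * sg (inord i) u v).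
  have := congr1 (fun p : {poly K} => p`_k) P; rewrite !coef_poly ltn_ord inord_val.
  have -> : (a + b - k = a + (b - k))%N by rewrite addnBA // ltnW.
  rewrite exprD mulrCA => /(mulfI _)-> //; by rewrite expf_neq0.
apply: poly_eq_off0 => c c0; rewrite !horner_poly.
have e0 : B / c != 0 by rewrite mulf_neq0 ?invr_eq0.
have := E c c0; rewrite Hsg // Hsg' // => /(congr1 ( *%R (c ^+ (a + b)))).
rewrite [_ ^+ (a + b)]exprD expr_div_n.
have -> : forall z, c ^+ a * c ^+ b * (B ^+ a / c ^+ a * (c ^- b * z)) = B ^+ a * z.
  by move=> z; field; rewrite !expf_neq0.
rewrite -exprD !mulr_sumr => E2.
transitivity (\sum_(i < (b + a).+1) c ^+ (a + b) * (sg' i v u * (B / c) ^+ i)); last first.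
  by rewrite E2; apply: eq_bigr => i _; rewrite inord_val mulrA.
rewrite (reindex_inj rev_ord_inj) /= -(big_mkord predT (fun i =>
  sg' (inord (a + b - ((a + b).+1 - i.+1))) v u * B ^+ (a + b - ((a + b).+1 - i.+1)) * c ^+ ((a
  + b).+1 - i.+1))).
rewrite {1}(addnC a b) big_mkord; apply: eq_bigr => i _.
have iD : (i <= a + b)%N by have := ltn_ord i; lia.
rewrite subSS subKn // inord_val expr_div_n.
have -> : c ^+ (a + b) = c ^+ (a + b - i) * c ^+ i by rewrite -exprD subnK.
by field; rewrite expf_neq0.
Qed.

(** The expansion is found where x_0 y_0 <> 0, then carried by curves to x_0 <> 0, by symmetry to
    y_0 <> 0, and at last to the locus x_0 = y_0 = 0, which neither chart meets. *)
Theorem section_spanned m n (C : 'M[K]_(m.+1, n.+1)) a b s :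
  C != 0 -> is_section (on_quadric C) a b s ->
  exists c, forall x y, on_quadric C x y ->
    s x y = \sum_(p <- normal_monos m.+1 n.+1 a b) c p * bimono p x y.
Proof.
move=> C0 sec; have [hx hy _] := sec.
have sec' := is_section_swap (@on_quadric_swap _ _ C) sec.
have [sg [Hsg /fin_all_exists[d Hd]]] := chart_coefs charK sec.
have [sg' [Hsg' /fin_all_exists[d' Hd']]] := chart_coefs charK sec'.
have swap := chart_coefs_swap sec Hsg Hsg'.
(* The chart at c = x_0, with y scaled by x_0, gives s as the sum of sg_k x_0^(k - b). For k < b,
   [swap] supplies the factor (x_0 y_0)^(b - k), which leaves y_0^(b - k). *)
pose Phi (x : 'cV[K]_m.+2) (y : 'cV[K]_n.+2) : K := \sum_(k < (a + b).+1)
  if (b <= k)%N then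
    \sum_(mv <- monos n.+1 b) \sum_(mu <- monos m.+1 (a + b - k))
      d k mu mv * (x ord0 ord0 ^+ (k - b) * mono mu (vtail x) * mono mv (vtail y))
  else
    \sum_(mu <- monos m.+1 a) \sum_(mv <- monos n.+1 k)
      d' (inord (a + b - k)) mv mu * (mono mu (vtail x) * (y ord0 ord0 ^+ (b - k) * mono mv
        (vtail y))).
have sPhi : normal_span a b Phi.
  apply: normal_span_sum => k _; have kD : (k <= a + b)%N by rewrite -ltnS.
  case: leqP => bk.
    have E : normal_span a b (fun x y => \sum_(mv <- monos n.+1 b | mdeg mv == b)
        \sum_(mu <- monos m.+1 (a + b - k) | mdeg mu == (a + b - k)%N)
        d k mu mv * (x ord0 ord0 ^+ (k - b) * mono mu (vtail x) * mono mv (vtail y))).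
      apply: normal_span_sum => mv /eqP Hmv; apply: normal_span_sum => mu /eqP Hmu.
      apply: normal_spanZ; apply: (@normal_span_mono _ _ _ _ (mcons (k - b) mu, mcons 0 mv)).
        rewrite mem_normal_monos /= !mcons0 eqxx orbT !mdeg_cons Hmv Hmu eqxx andbT /=; lia.
      move=> x y; rewrite /bimono /= -[in RHS](vconsK x) -[in RHS](vconsK y) !mono_cons expr0
        mul1r.
      by [].
    have [c Hc] := E; exists c => x y; rewrite -Hc.
    rewrite big_seq_cond [RHS]big_seq_cond; apply: eq_big => [mv|mv];
      rewrite andbT mem_monos ?andbb // => _.
    by rewrite big_seq_cond [RHS]big_seq_cond; apply: eq_bigl => mu;
      rewrite mem_monos andbT andbb.
  have E : normal_span a b (fun x y => \sum_(mu <- monos m.+1 a | mdeg mu == a)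
        \sum_(mv <- monos n.+1 k | mdeg mv == k)
      d' (inord (a + b - k)) mv mu * (mono mu (vtail x) * (y ord0 ord0 ^+ (b - k) * mono mv
        (vtail y)))).
    apply: normal_span_sum => mu /eqP Hmu; apply: normal_span_sum => mv /eqP Hmv.
    apply: normal_spanZ; apply: (@normal_span_mono _ _ _ _ (mcons 0 mu, mcons (b - k) mv)).
      rewrite mem_normal_monos /= !mcons0 eqxx !mdeg_cons Hmv Hmu eqxx /=; lia.
    by move=> x y; rewrite /bimono /= -[in RHS](vconsK x) -[in RHS](vconsK y) !mono_cons expr0
      mul1r.
  have [c Hc] := E; exists c => x y; rewrite -Hc.
  rewrite big_seq_cond [RHS]big_seq_cond; apply: eq_big => [mu|mu];
    rewrite andbT mem_monos ?andbb // => _.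
  by rewrite big_seq_cond [RHS]big_seq_cond; apply: eq_bigl => mv; rewrite mem_monos andbT andbb.
have cPhi := normal_span_curvewise sPhi.
have [c Hc] := sPhi; exists c => x y; rewrite -Hc.
have core x1 y1 : on_quadric C x1 y1 -> x1 ord0 ord0 != 0 -> y1 ord0 ord0 != 0 ->
  s x1 y1 = Phi x1 y1.
  rewrite -{1 2 3}(vconsK x1) -{1 2 3}(vconsK y1) /Phi.
  move: (x1 _ _) (vtail x1) (y1 _ _) (vtail y1) => {x y x1 y1} e u f v.
  rewrite !vcons0 => Z1 e0 f0; have /on_quadric_cons[_ _ Ez] := Z1.
  have EB : - bil C u v = e * f by apply/eqP; rewrite eq_sym -addr_eq0 Ez.
  have B0 : bil C u v != 0 by rewrite -oppr_eq0 EB mulf_neq0.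
  have u0 : u != 0 by apply: contraNneq B0 => ->; rewrite bil0l.
  have v0 : v != 0 by apply: contraNneq B0 => ->; rewrite bil0r.
  have := Hsg e u v e0 u0 v0; rewrite /chart EB -vconsZ hy // => /(congr1 ( *%R (e ^- b))).
  rewrite mulKf ?expf_neq0 // => ->; rewrite mulr_sumr; apply: eq_bigr => k _.
  have kD : (k <= a + b)%N by rewrite -ltnS.
  case: leqP => bk.
    have -> : e ^+ k = e ^+ (k - b) * e ^+ b by rewrite -exprD subnK.
    transitivity (sg k u v * e ^+ (k - b)); first by field; rewrite expf_neq0.
    rewrite Hd // mulr_suml; apply: eq_bigr => mv _.
    by rewrite mulr_suml; apply: eq_bigr => mu _; ring.
  rewrite swap // EB Hd' // inordK; last by lia.
  have -> : (b + a - (a + b - k) = k)%N by lia.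
  set S := \sum_(mu <- _) _; transitivity (f ^+ (b - k) * S).
    have -> : e ^+ b = e ^+ (b - k) * e ^+ k by rewrite -exprD subnK // ltnW.
    by rewrite exprMn; field; rewrite !expf_neq0.
  rewrite mulr_sumr; apply: eq_bigr => mu _; rewrite mulr_sumr; apply: eq_bigr => mv _.
  by ring.
move=> Zxy; have [x0|x0] := eqVneq (x ord0 ord0) 0;
  last exact: (section_extend_x0 sec C0 cPhi core).
have [y0|y0] := eqVneq (y ord0 ord0) 0; last first.
  have CT0 : C^T != 0 by rewrite trmx_eq0.
  have cPhi' : curvewise_poly (fun y x => Phi x y) by move=> Y X; have [g Hg] := cPhi X Y;
    exists g => t; exact: Hg.
  apply: (section_extend_x0 sec' CT0 cPhi') => //; last exact: (iffLR (on_quadric_swap C x y)).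
  by move=> y1 x1 /(iffRL (on_quadric_swap C x1 y1)) Z1 y10 x10; apply: core.
(* When y_0 = 0 the equation does not involve x_0, which can therefore vary freely away from 0. *)
have Zt t : on_quadric C (ev (vcons 'X (map_mx polyC (vtail x))) t) (ev (map_mx polyC y) t).
  case: Zxy => xn yn; rewrite y0 mulr0 add0r => B0; split=> //.
  - rewrite ev_vcons ev_const vcons_eq0 negb_and.
    by move: xn; rewrite -{1}(vconsK x) vcons_eq0 x0 eqxx /= orbC => ->.
  - by rewrite ev_const.
  - by rewrite ev_const y0 mulr0 add0r ev_vcons vtail_cons ev_const.
have Ex : x = ev (vcons 'X (map_mx polyC (vtail x))) 0.
  by rewrite ev_vcons ev_const hornerX -x0 vconsK.
have Ey : y = ev (map_mx polyC y) 0 by rewrite ev_const.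
rewrite Ex Ey; apply: (section_extend (r := 'X) sec cPhi); rewrite ?polyX_eq0 //.
move=> t; rewrite hornerX => t0; split=> //.
apply: (section_extend_x0 sec C0 cPhi core) => //.
by rewrite ev_vcons vcons0 hornerX.
Qed.

End Spanning.

(** * Linear independence of the normal monomials *)

Section Independence.
Variable K : closedFieldType.

Lemma exp_free (I : Type) (r : seq I) (c : I -> K) (e : I -> nat) :
  (forall z, z != 0 -> \sum_(i <- r) c i * z ^+ e i = 0) ->
  forall k, \sum_(i <- r | e i == k) c i = 0.
Proof.
move=> H k; have E : \sum_(i <- r) c i *: 'X^(e i) = 0 :> {poly K}.
  apply: poly_eq_off0 => z z0; rewrite horner0 -[RHS](H z z0) horner_sum.
  by apply: eq_bigr => i _; rewrite hornerZ hornerXn.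
have := congr1 (fun p : {poly K} => p`_k) E; rewrite coef0 coef_sum => {}E;
  rewrite -[RHS]E big_mkcond; apply: eq_bigr => i _.
by rewrite coefZ coefXn eq_sym; case: eqP => _; rewrite ?mulr1 ?mulr0.
Qed.

(** The exponents may repeat in the family: removing the first variable makes distinct exponents
    coincide, so the induction needs this generality. *)
Lemma mono_free n (I : Type) (r : seq I) (c : I -> K) (e : I -> 'X_{1..n}) :
  (forall v, \sum_(i <- r) c i * mono (e i) v = 0) ->
  forall m, \sum_(i <- r | e i == m) c i = 0.
Proof.
elim: n => [|n IHn] in I r c e *.
  move=> H m; rewrite -[RHS](H 0); apply: eq_big => [i|i _].
    by rewrite [e i]nvar0_mnmE [m]nvar0_mnmE eqxx.
  by rewrite /mono big_ord0 mulr1.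
move=> H m.
have {}H k w : \sum_(i <- [seq i <- r | e i ord0 == k]) c i * mono (mtail (e i)) w = 0.
  rewrite big_filter; apply: (exp_free (e := fun i => e i ord0)) => z _.
  rewrite -[RHS](H (vcons z w)); apply: eq_bigr => i _.
  by rewrite -[in mono (e i) _](mconsK (e i)) mono_cons; ring.
have := IHn _ _ _ _ (H (m ord0)) (mtail m); rewrite big_filter_cond => E; rewrite -[RHS]E.
apply: eq_bigl => i; apply/eqP/andP => [->|[/eqP E1 /eqP E2]]; first by rewrite !eqxx.
by rewrite -(mconsK (e i)) E1 E2 mconsK.
Qed.

Lemma bimono_free m n (I : Type) (r : seq I) (c : I -> K) (e : I -> 'X_{1..m} * 'X_{1..n}) :
  (forall u v, \sum_(i <- r) c i * bimono (e i) u v = 0) ->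
  forall p, \sum_(i <- r | e i == p) c i = 0.
Proof.
move=> H [mu mv].
have {}H v : \sum_(i <- [seq i <- r | (e i).1 == mu]) c i * mono (e i).2 v = 0.
  rewrite big_filter; apply: (mono_free (e := fun i => (e i).1)) => u.
  by rewrite -[RHS](H u v); apply: eq_bigr => i _; rewrite /bimono; ring.
have := mono_free H mv; rewrite big_filter_cond => E; rewrite -[RHS]E.
by apply: eq_bigl => i; rewrite -pair_eqE.
Qed.

(* The curves ((z, u), (- bil C u v / z, v)) separate the monomials according to the difference
   of their exponents in x_0 and y_0, and this difference determines both exponents. *)
Lemma normal_monos_free m n (C : 'M[K]_(m, n)) a b (c : 'X_{1..m.+1} * 'X_{1..n.+1} -> K) :
  C != 0 ->
  (forall x y, on_quadric C x y -> \sum_(p <- normal_monos m n a b) c p * bimono p x y = 0) ->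
  forall p, p \in normal_monos m n a b -> c p = 0.
Proof.
move=> C0 H p0 Hp0; set r := normal_monos m n a b in H Hp0.
(* The difference of the exponents of x_0 and y_0, shifted by [b] to be a natural number. *)
pose kappa (p : 'X_{1..m.+1} * 'X_{1..n.+1}) := (p.1 ord0 + (b - p.2 ord0))%N.
pose tails (p : 'X_{1..m.+1} * 'X_{1..n.+1}) := (mtail p.1, mtail p.2).
have p2b p : p \in r -> (p.2 ord0 <= b)%N.
  rewrite mem_normal_monos => /and3P[_ _ /eqP<-].
  by rewrite -[in mdeg _](mconsK p.2) mdeg_cons leq_addr.
(* One of the two exponents is 0: if that of y_0 is, then kappa >= b and the truncated difference is
   0 as well. *)
have kappa1 p : p \in r -> p.2 ord0 = (b - kappa p)%N.
  move=> Hp; have := p2b p Hp; move: Hp; rewrite mem_normal_monos /kappa => /and3P[+ _ _].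
  by move: (p.1 ord0) (p.2 ord0) => i j /orP[]/eqP->; lia.
pose r' := [seq p <- r | kappa p == kappa p0].
have off u v : bil C u v != 0 -> \sum_(p <- r') c p * bimono (tails p) u v = 0.
  move=> B0; pose B := - bil C u v; have {}B0 : B != 0 by rewrite oppr_eq0.
  have E : \sum_(p <- r | kappa p == kappa p0) c p * B ^+ p.2 ord0 * bimono (tails p) u v = 0.
    apply: (exp_free (e := kappa)) => z z0.
    have Z : on_quadric C (vcons z u) (vcons (B / z) v).
      apply/on_quadric_cons; rewrite z0 mulf_neq0 ?invr_eq0 //; split=> //.
      by rewrite /B; field.
    rewrite -[RHS](mulr0 (z ^+ b)) -[in RHS](H _ _ Z) mulr_sumr big_seq [RHS]big_seq.
    apply: eq_bigr => p /p2b pb; rewrite /bimono -[in RHS](mconsK p.1) -[in RHS](mconsK p.2).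
    rewrite !mono_cons /kappa exprD expr_div_n.
    have -> : z ^+ b = z ^+ (b - p.2 ord0) * z ^+ p.2 ord0 by rewrite -exprD subnK.
    by rewrite /=; field; rewrite expf_neq0.
  apply: (mulfI (x := B ^+ (b - kappa p0))); first by rewrite expf_neq0.
  rewrite mulr0 -[RHS]E big_filter mulr_sumr big_seq_cond [RHS]big_seq_cond.
  apply: eq_bigr => p /andP[/kappa1 -> /eqP->]; ring.
(* The line from (u, v) to a pair of coordinate vectors with [C i j] nonzero meets bil C = 0 in
   finitely many points, so the vanishing in [off] extends to its origin. *)
have /bimono_free free u v : \sum_(p <- r') c p * bimono (tails p) u v = 0.
  have /matrix0Pn[i [j Cij]] := C0.
  pose u1 : 'cV[K]_m := delta_mx i ord0; pose v1 : 'cV[K]_n := delta_mx j ord0.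
  pose X := line u (u1 - u); pose Y := line v (v1 - v).
  have [g Hg] := curvewise_poly_sum r' c (fun p =>
    curvewise_poly_mono (K := K) (tails p).1 (tails p).2) X Y.
  pose q := bil (map_mx polyC C) X Y.
  have q0 : q != 0.
    apply/negP => /eqP/(congr1 (horner^~ 1))/eqP.
    rewrite horner_bil !ev_line !scale1r ![_ + (_ - _)]addrC !subrK horner0.
    by rewrite bil_delta (negPf Cij).
  have g0 : g = 0.
    apply: (poly_eq0_off_roots q0) => t; rewrite horner_bil => /off.
    by rewrite -Hg.
  have := Hg 0; rewrite g0 horner0 !ev_line !scale0r !addr0.
  by [].
have := free (tails p0); rewrite big_filter_cond.
rewrite big_seq_cond (eq_bigl (fun p => p == p0)) => [|p].
  rewrite big_mkcond (bigD1_seq p0) ?normal_monos_uniq //= eqxx big1 ?addr0 // => p /negPf->.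
  by [].
apply/and3P/eqP => [[Hp /eqP Ek /eqP Et]|->]; last by rewrite Hp0 !eqxx.
have E3 : p.2 ord0 = p0.2 ord0 by rewrite !kappa1 // Ek.
have E4 : p.1 ord0 = p0.1 ord0 by move: Ek; rewrite /kappa E3 => /eqP; rewrite eqn_add2r => /eqP.
rewrite [p]surjective_pairing [p0]surjective_pairing.
have E1 : mtail p.1 = mtail p0.1 by apply: (congr1 fst Et).
have E2 : mtail p.2 = mtail p0.2 by apply: (congr1 snd Et).
by rewrite -(mconsK p.1) -(mconsK p.2) E1 E2 E3 E4 !mconsK.
Qed.

End Independence.

(** * Bihomogeneous polynomials *)

Section Bihomogeneity.
Variables (R : nzRingType) (m n : nat).
Implicit Types p q : {mpoly R[m.+1 + n.+1]}.

Lemma xdegD (mon mon' : 'X_{1..m.+1 + n.+1}) : xdeg (mon + mon')%MM = (xdeg mon + xdeg mon')%N.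
Proof. by rewrite /xdeg -big_split; apply: eq_bigr => i _; rewrite mnmDE. Qed.

Lemma ydegD (mon mon' : 'X_{1..m.+1 + n.+1}) : ydeg (mon + mon')%MM = (ydeg mon + ydeg mon')%N.
Proof. by rewrite /ydeg -big_split; apply: eq_bigr => i _; rewrite mnmDE. Qed.

Lemma bihomogM a b c d p q : bihomog a b p -> bihomog c d q -> bihomog (a + c) (b + d) (p * q).
Proof.
move=> Hp Hq mon /msuppM_le/allpairsP[[m1 m2] /= [/Hp[x1 y1] /Hq[x2 y2] ->]].
by rewrite xdegD ydegD x1 x2 y1 y2.
Qed.

Lemma bihomog1 : bihomog 0 0 (1 : {mpoly R[m.+1 + n.+1]}).
Proof.
move=> mon; rewrite -mpolyC1 msupp1 inE => /eqP->.
by split; rewrite /xdeg /ydeg big1 // => i _; rewrite mnm0E.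
Qed.

Lemma bihomogX a b p k : bihomog a b p -> bihomog (k * a) (k * b) (p ^+ k).
Proof.
move=> H; elim: k => [|k IH]; first exact: bihomog1.
by rewrite exprS !mulSn; apply: bihomogM.
Qed.

Lemma bihomog_prod (I : Type) (r : seq I) (a b : I -> nat) (p : I -> {mpoly R[m.+1 + n.+1]}) :
  (forall i, bihomog (a i) (b i) (p i)) ->
  bihomog (\sum_(i <- r) a i) (\sum_(i <- r) b i) (\prod_(i <- r) p i).
Proof.
move=> H; elim: r => [|i r IH]; first by rewrite !big_nil; exact: bihomog1.
by rewrite !big_cons; apply: bihomogM.
Qed.

Lemma bihomog_sum (I : Type) (r : seq I) a b (p : I -> {mpoly R[m.+1 + n.+1]}) :
  (forall i, bihomog a b (p i)) -> bihomog a b (\sum_(i <- r) p i).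
Proof.
move=> H; elim: r => [|i r IH]; first by rewrite big_nil => mon; rewrite -mpolyC0 msupp0.
by rewrite big_cons => mon /msuppD_le; rewrite mem_cat => /orP[/H|/IH].
Qed.

Lemma bihomogZ a b c p : bihomog a b p -> bihomog a b (c *: p).
Proof. by move=> H mon /msuppZ_le/H. Qed.

Lemma bihomog_lshift (i : 'I_m.+1) : bihomog 1 0 ('X_(lshift n.+1 i) : {mpoly R[m.+1 + n.+1]}).
Proof.
move=> mon; rewrite msuppX inE => /eqP->; split; rewrite /xdeg /ydeg.
  rewrite (bigD1 i) //= mnm1E eqxx big1 // => j ne.
  by rewrite mnm1E eq_lshift eq_sym (negPf ne).
by rewrite big1 // => j _; rewrite mnm1E eq_lrshift.
Qed.

Lemma bihomog_rshift (j : 'I_n.+1) : bihomog 0 1 ('X_(rshift m.+1 j) : {mpoly R[m.+1 + n.+1]}).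
Proof.
move=> mon; rewrite msuppX inE => /eqP->; split; rewrite /xdeg /ydeg.
  by rewrite big1 // => i _; rewrite mnm1E eq_rlshift.
rewrite (bigD1 j) //= mnm1E eqxx big1 // => i ne.
by rewrite mnm1E eq_rshift eq_sym (negPf ne).
Qed.

End Bihomogeneity.

Section Evaluation.
Variables (K : closedFieldType) (m n : nat).

Lemma coord_lshift (R : nzRingType) (x : 'cV[R]_m.+1) (y : 'cV[R]_n.+1) i :
  Defs.coord x y (lshift n.+1 i) = x i ord0.
Proof. by rewrite /Defs.coord col_mxEu. Qed.

Lemma coord_rshift (R : nzRingType) (x : 'cV[R]_m.+1) (y : 'cV[R]_n.+1) j :
  Defs.coord x y (rshift m.+1 j) = y j ord0.
Proof. by rewrite /Defs.coord col_mxEd. Qed.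

Definition xpart (mon : 'X_{1..m.+1 + n.+1}) : 'X_{1..m.+1} := [multinom mon (lshift n.+1 i) | i
  < m.+1].
Definition ypart (mon : 'X_{1..m.+1 + n.+1}) : 'X_{1..n.+1} := [multinom mon (rshift m.+1 i) | i
  < n.+1].

Lemma mdeg_xpart mon : mdeg (xpart mon) = xdeg mon.
Proof. by rewrite mdegE; apply: eq_bigr => i _; rewrite mnmE. Qed.

Lemma mdeg_ypart mon : mdeg (ypart mon) = ydeg mon.
Proof. by rewrite mdegE; apply: eq_bigr => i _; rewrite mnmE. Qed.

Lemma coord_mono (R : comNzRingType) (x : 'cV[R]_m.+1) (y : 'cV[R]_n.+1) (mon : 'X_{1..m.+1 +
  n.+1}) :
  \prod_i Defs.coord x y i ^+ mon i = mono (xpart mon) x * mono (ypart mon) y.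
Proof.
rewrite big_split_ord; congr (_ * _); apply: eq_bigr => i _.
  by rewrite coord_lshift mnmE.
by rewrite coord_rshift mnmE.
Qed.

Lemma meval_coordE (f : {mpoly K[m.+1 + n.+1]}) x y :
  f.@[Defs.coord x y] = \sum_(mon <- msupp f) f@_mon * (mono (xpart mon) x * mono (ypart mon) y).
Proof. by rewrite mevalE; apply: eq_bigr => mon _; rewrite coord_mono. Qed.

Lemma evalE (p : {mpoly {poly K}[m.+1 + n.+1]}) x y t :
  eval p (Point x y t) =
  \sum_(mon <- msupp p) (p@_mon).[t] * (mono (xpart mon) x * mono (ypart mon) y).
Proof.
rewrite /eval mevalE horner_sum; apply: eq_bigr => mon _; rewrite hornerM; congr (_ * _).
by rewrite -coord_mono horner_prod; apply: eq_bigr => i _; rewrite horner_exp hornerC.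
Qed.

Lemma evalM (p q : {mpoly {poly K}[m.+1 + n.+1]}) (P : point K m n) : eval (p * q) P = eval p P
  * eval q P.
Proof. by rewrite /eval mevalM hornerM. Qed.

Lemma eval1 (P : point K m n) : eval (1 : {mpoly {poly K}[m.+1 + n.+1]}) P = 1.
Proof. by rewrite /eval meval1 hornerC. Qed.

Lemma eval_curvewise (p : {mpoly {poly K}[m.+1 + n.+1]}) t : curvewise_poly (fun x y =>
  eval p (Point x y t) : K).
Proof.
move=> X Y; have [g Hg] := curvewise_poly_sum (msupp p) (fun mon => (p@_mon).[t])
  (fun mon => curvewise_poly_mono (K := K) (xpart mon) (ypart mon)) X Y.
by exists g => u; rewrite -Hg evalE.
Qed.

Lemma evalZ i j (p : {mpoly {poly K}[m.+1 + n.+1]}) (c d : K) x y t : bihomog i j p ->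
  eval p (Point (c *: x) (d *: y) t) = c ^+ i * d ^+ j * eval p (Point x y t) :> K.
Proof.
move=> Hp; rewrite !evalE mulr_sumr big_seq [RHS]big_seq; apply: eq_bigr => mon /Hp[Hx Hy].
by rewrite !monoZ mdeg_xpart mdeg_ypart Hx Hy; ring.
Qed.

Lemma meval_coordZ i j (f : {mpoly K[m.+1 + n.+1]}) (c d : K) x y : bihomog i j f ->
  f.@[Defs.coord (c *: x) (d *: y)] = c ^+ i * d ^+ j * f.@[Defs.coord x y].
Proof.
move=> Hp; rewrite !meval_coordE mulr_sumr big_seq [RHS]big_seq; apply: eq_bigr => mon /Hp[Hx Hy].
by rewrite !monoZ mdeg_xpart mdeg_ypart Hx Hy; ring.
Qed.

Lemma meval_eq0 k (p : {mpoly K[k]}) : (forall v, p.@[v] = 0) -> p = 0.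
Proof.
move=> H; apply/mpolyP => mon; rewrite mcoeff0.
have [Hm|/memN_msupp_eq0//] := boolP (mon \in msupp p).
have := @mono_free K k _ (msupp p) (fun mon => p@_mon) id _ mon.
rewrite big_mkcond (bigD1_seq mon) ?msupp_uniq //= eqxx big1 ?addr0; last by move=> i /negPf->.
by apply=> v; rewrite -[RHS](H (fun i => v i ord0)) mevalE.
Qed.

Lemma meval_coord_ext (p q : {mpoly K[m.+1 + n.+1]}) :
  (forall x y, p.@[Defs.coord x y] = q.@[Defs.coord x y]) -> p = q.
Proof.
move=> H; apply/eqP; rewrite -subr_eq0; apply/eqP/meval_eq0 => v.
rewrite mevalB; apply/eqP; rewrite subr_eq0; apply/eqP.
have E : v =1 Defs.coord (\col_i v (lshift n.+1 i)) (\col_j v (rshift m.+1 j)).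
  by move=> i; rewrite -(splitK i); case: split => j /=; rewrite ?coord_lshift ?coord_rshift mxE.
by rewrite !(meval_eq _ E).
Qed.

Lemma regular_section_fiber (f : {mpoly K[m.+1 + n.+1]}) i j Z a b s t : bihomog i j f ->
  (forall x y, on_hypersurface f x y -> Z (Point x y t)) ->
  regular_section Z a b s ->
  is_section (on_hypersurface f) a b (fun x y => s (Point x y t) : K).
Proof.
move=> Hf HZ loc.
have scale x y (c d : K) : c != 0 -> d != 0 -> on_hypersurface f x y ->
    on_hypersurface f (c *: x) (d *: y) /\
    s (Point (c *: x) (d *: y) t) = c ^+ a * d ^+ b * s (Point x y t).
  move=> c0 d0 Hxy; have [x0 y0 fxy] := Hxy.
  have Hcd : on_hypersurface f (c *: x) (d *: y).
    by split; rewrite ?scaler_eq0 ?negb_or ?c0 ?d0 // (meval_coordZ _ _ _ _ Hf) fxy mulr0.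
  split=> //; have [i' [j' [p [q [hp hq qP Hpq]]]]] := loc _ (HZ _ _ Hxy).
  have qcd : eval q (Point (c *: x) (d *: y) t) != 0.
    by rewrite (evalZ _ _ _ _ _ hq) !mulf_neq0 // expf_neq0.
  rewrite !Hpq //; try exact: HZ.
  rewrite (evalZ _ _ _ _ _ hq) (evalZ _ _ _ _ _ hp) !exprD.
  by field; rewrite !expf_neq0 // qP.
split=> [c x y c0 Hxy|c x y c0 Hxy|x y Hxy].
- by have [_] := scale x y c 1 c0 (oner_neq0 _) Hxy; rewrite scale1r expr1n mulr1.
- by have [_] := scale x y 1 c (oner_neq0 _) c0 Hxy; rewrite scale1r expr1n mul1r.
have [i' [j' [p [q [hp hq qP Hpq]]]]] := loc _ (HZ _ _ Hxy).
exists (fun x y => eval p (Point x y t)), (fun x y => eval q (Point x y t)).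
by split; [exact: eval_curvewise|exact: eval_curvewise|exact: qP|move=> x' y' /HZ; exact: Hpq].
Qed.

Lemma is_section_linear m1 n1 (Z Z' : 'cV[K]_m1 -> 'cV[K]_n1 -> Prop) a b s P Q :
  (forall x y, Z' x y -> Z (P *m x) (Q *m y)) -> is_section Z a b s ->
  is_section Z' a b (fun x y => s (P *m x) (Q *m y)).
Proof.
have evmul k (A : 'M[K]_k) X t : A *m ev X t = ev (map_mx polyC A *m X) t.
  apply/colP => i; rewrite !mxE horner_sum; apply: eq_bigr => j _.
  by rewrite !mxE hornerM hornerC.
have cw p : curvewise_poly p -> curvewise_poly (fun x y => p (P *m x) (Q *m y) : K).
  move=> cp X Y; have [g Hg] := cp (map_mx polyC P *m X) (map_mx polyC Q *m Y).
  by exists g => t; rewrite !evmul.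
move=> ZZ' [hx hy loc]; split=> [c x y c0 /ZZ' Z1|c x y c0 /ZZ' Z1|x y /ZZ' Z1].
- by rewrite -scalemxAr hx.
- by rewrite -scalemxAr hy.
have [p [q [cp cq qxy Hpq]]] := loc _ _ Z1.
exists (fun x y => p (P *m x) (Q *m y)), (fun x y => q (P *m x) (Q *m y)).
split=> //; [exact: cw|exact: cw|move=> x' y' /ZZ'; exact: Hpq].
Qed.

Lemma bimono_regular (E : 'M[K]_m.+1) (F : 'M[K]_n.+1) (mu : 'X_{1..m.+1}) (mv : 'X_{1..n.+1}) Z :
  regular_section Z (mdeg mu) (mdeg mv) (fun P => bimono (mu, mv) (E *m px P) (F *m py P)).
Proof.
pose lx i : {mpoly {poly K}[m.+1 + n.+1]} := \sum_j (E i j)%:P *: 'X_(lshift n.+1 j).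
pose ly i : {mpoly {poly K}[m.+1 + n.+1]} := \sum_j (F i j)%:P *: 'X_(rshift m.+1 j).
pose p := (\prod_i lx i ^+ mu i) * (\prod_i ly i ^+ mv i).
have Hp : bihomog (mdeg mu) (mdeg mv) p.
  have hx i : bihomog 1 0 (lx i) by apply: bihomog_sum => j; exact/bihomogZ/bihomog_lshift.
  have hy i : bihomog 0 1 (ly i) by apply: bihomog_sum => j; exact/bihomogZ/bihomog_rshift.
  have := bihomogM (bihomog_prod (r := index_enum 'I_m.+1) (fun i => bihomogX (k := mu i) (hx i)))
                   (bihomog_prod (r := index_enum 'I_n.+1) (fun i =>
                     bihomogX (k := mv i) (hy i))).
  have sum0 k (e : 'X_{1..k}) : \sum_i (e i * 0)%N = 0%N by rewrite big1 // => i _; rewrite muln0.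
  have sum1 k (e : 'X_{1..k}) : \sum_i (e i * 1)%N = mdeg e by rewrite mdegE;
    apply: eq_bigr => i _; rewrite muln1.
  by rewrite !sum0 !sum1 addn0.
have Ep P : eval p P = bimono (mu, mv) (E *m px P) (F *m py P).
  rewrite evalM /bimono /mono /eval !rmorph_prod /= !horner_prod.
  congr (_ * _); apply: eq_bigr => i _; rewrite rmorphXn /= horner_exp; congr (_ ^+ _).
    rewrite raddf_sum horner_sum mxE; apply: eq_bigr => j _.
    by rewrite /= mevalZ mevalXU hornerM !hornerC coord_lshift.
  rewrite raddf_sum horner_sum mxE; apply: eq_bigr => j _.
  by rewrite /= mevalZ mevalXU hornerM !hornerC coord_rshift.
move=> P _; exists 0%N, 0%N, p, 1; rewrite !addn0; split=> //.
- exact: bihomog1.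
- by rewrite eval1 oner_neq0.
by move=> Q _ _; rewrite eval1 divr1 Ep.
Qed.

Lemma mono_mdeg1 k (mon : 'X_{1..k}) : mdeg mon = 1%N ->
  exists i, forall v : 'cV[K]_k, mono mon v = v i ord0.
Proof.
move=> /eqP/mdeg1P[i /eqP->]; exists i => v.
rewrite /mono (bigD1 i) //= mnm1E eqxx expr1 big1 ?mulr1 // => j ne.
by rewrite mnm1E eq_sym (negPf ne) expr0.
Qed.

Lemma bihomog11_bil (f : {mpoly K[m.+1 + n.+1]}) : bihomog 1 1 f ->
  exists M : 'M[K]_(m.+1, n.+1), forall x y, f.@[Defs.coord x y] = bil M x y.
Proof.
move=> Hf.
suff [M HM] : exists M : 'M[K]_(m.+1, n.+1), forall x y,
    \sum_(mon <- msupp f) f@_mon * (mono (xpart mon) x * mono (ypart mon) y) = bil M x y.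
  by exists M => x y; rewrite meval_coordE HM.
have : {subset msupp f <= msupp f} by [].
elim: {-2}(msupp f) => [|mon r IH] sub.
  exists 0 => x y; rewrite big_nil /bil big1 // => i _; rewrite big1 // => j _.
  by rewrite mxE !mul0r.
have [|M HM] := IH; first by move=> mon' Hm; apply: sub; rewrite inE Hm orbT.
have [|Hx Hy] := Hf mon; first by apply: sub; rewrite inE eqxx.
have [i Hi] := @mono_mdeg1 _ (xpart mon) (etrans (mdeg_xpart mon) Hx).
have [j Hj] := @mono_mdeg1 _ (ypart mon) (etrans (mdeg_ypart mon) Hy).
exists (f@_mon *: delta_mx i j + M) => x y; rewrite big_cons HM Hi Hj /bil.
under [RHS]eq_bigr do under eq_bigr do rewrite !mxE mulrDl mulrDl.
under [RHS]eq_bigr do rewrite big_split.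
rewrite big_split /=; congr (_ + _).
rewrite (bigD1 i) //= (bigD1 j) //= !eqxx !big1 ?addr0 => [|k nk|k /negPf->].
- by rewrite mulr1 mulrA.
- by rewrite big1 // => l _; rewrite (negPf nk) mulr0 !mul0r.
by rewrite andbF mulr0 !mul0r.
Qed.

(** Otherwise f is a product of a linear form in x and one in y, and divides one of them. But f
    vanishes whenever x = 0 or y = 0, whereas each form takes the value 1 at a point whose other
    vector is 0. *)
Lemma prime_bil_not_rank1 (f : {mpoly K[m.+1 + n.+1]}) (E : 'M[K]_m.+1) (F : 'M[K]_n.+1) :
  bihomog 1 1 f -> prime_poly f -> E \in unitmx -> F \in unitmx ->
  ~ (forall x y, f.@[Defs.coord x y] = (E *m x) ord0 ord0 * (F *m y) ord0 ord0).
Proof.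
move=> Hf [_ _ pr] Eu Fu H.
pose lx : {mpoly K[m.+1 + n.+1]} := \sum_j E ord0 j *: 'X_(lshift n.+1 j).
pose ly : {mpoly K[m.+1 + n.+1]} := \sum_j F ord0 j *: 'X_(rshift m.+1 j).
have Elx x y : lx.@[Defs.coord x y] = (E *m x) ord0 ord0.
  rewrite raddf_sum mxE; apply: eq_bigr => j _.
  by rewrite /= mevalZ mevalXU coord_lshift.
have Ely x y : ly.@[Defs.coord x y] = (F *m y) ord0 ord0.
  rewrite raddf_sum mxE; apply: eq_bigr => j _.
  by rewrite /= mevalZ mevalXU coord_rshift.
have Ef : lx * ly = 1 * f.
  by apply: meval_coord_ext => x y; rewrite mul1r mevalM Elx Ely H.
have [|[c /(congr1 (meval _)) Ec]|[c /(congr1 (meval _)) Ec]] := pr lx ly; first by exists 1.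
  have := Ec (Defs.coord (invmx E *m delta_mx ord0 ord0) 0).
  rewrite Elx mevalM H mulmx0 mulKVmx // !mxE !eqxx !mulr0 => /eqP.
  by rewrite oner_eq0.
have := Ec (Defs.coord 0 (invmx F *m delta_mx ord0 ord0)).
rewrite Ely mevalM H mulmx0 mulKVmx // !mxE !eqxx mul0r mulr0 => /eqP.
by rewrite oner_eq0.
Qed.

End Evaluation.

(** * One-parameter subgroups *)

Section Weights.
Variable K : closedFieldType.

Lemma expz_inj (w z : int) : (forall t : K, t != 0 -> t ^ w = t ^ z) -> w = z.
Proof.
move=> H; apply/eqP; rewrite -subr_eq0; apply/eqP.
have {}H t : t != 0 :> K -> t ^ (w - z) = 1.
  by move=> t0; rewrite expfzDr // H // -expfzDr // subrr expr0z.
have {}H t : t != 0 :> K -> t ^+ `|w - z|%N = 1.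
  move=> t0; have := H t t0; case: (intP (w - z)) => [||] //= k; rewrite ?NegzE ?abszN //.
  by rewrite -exprnN => /eqP; rewrite invr_eq1 => /eqP.
apply/eqP; rewrite -absz_eq0 -leqn0 leqNgt; apply/negP => k0.
have E : 'X^`|w - z|%N = 1 :> {poly K}.
  by apply: poly_eq_off0 => t t0; rewrite hornerXn H // hornerE.
by have := congr1 (fun p => size (p : {poly K})) E; rewrite /= size_polyXn size_poly1 => -[]; lia.
Qed.

Lemma idempotent_diagonalizable n (A : 'M[K]_n.+1) : A *m A = A -> diagonalizable A.
Proof.
move=> AA; apply/diagonalizableP; exists [:: 0; 1]; first by rewrite /= inE eq_sym oner_eq0.
rewrite !big_cons big_nil mulr1 mxminpoly_min // rmorphM !rmorphB /= horner_mx_X !horner_mx_C.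
by rewrite /= raddf0 subr0 -[_ * _]/(A *m (A - 1%:M)) mulmxBr AA mulmx1 subrr.
Qed.

(* A one-parameter group of matrices A(t) = sum_k t^(k-N) P_k is multiplicative exactly
   when the P_k are orthogonal idempotents with sum 1. *)
Lemma one_ps_diagonalizable n (A : K -> 'M[K]_n.+1) :
  laurent_mx A -> (forall t, t != 0 -> \det (A t) = 1) ->
  (forall s t, s != 0 -> t != 0 -> A (s * t) = A s *m A t) ->
  exists (E : 'M[K]_n.+1) (w : 'I_n.+1 -> int), [/\ E \in unitmx, \sum_i w i = 0
    & forall t, t != 0 -> E *m A t = diag_mx (\row_i t ^ w i) *m E].
Proof.
move=> [N [P HP]] dA AM.
pose D := \max_i \max_j size (P i j).
pose Q (k : nat) : 'M[K]_n.+1 := \matrix_(i, j) (P i j)`_k.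
have EA t : t != 0 -> A t = t ^- N *: \sum_(k < D) t ^+ k *: Q k.
  move=> t0; rewrite HP //; congr (_ *: _); apply/matrixP => i j.
  rewrite !mxE summxE (@horner_coef_wide _ D); last first.
    by apply: leq_trans (leq_bigmax i); apply: (leq_trans _ (leq_bigmax j)).
  by apply: eq_bigr => k _; rewrite !mxE mulrC.
have coef (B B' : nat -> 'M[K]_n.+1) : (forall t : K, t != 0 ->
    \sum_(k < D) t ^+ k *: B k = \sum_(k < D) t ^+ k *: B' k) ->
    forall k, (k < D)%N -> B k = B' k.
  move=> H k kD; apply/matrixP => i j.
  have entry t (M : nat -> 'M[K]_n.+1) :
      \sum_(k < D) M k i j * t ^+ k = (\sum_(k < D) t ^+ k *: M k) i j.
    by rewrite summxE; apply: eq_bigr => h _; rewrite mxE mulrC.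
  have E : \poly_(k < D) B k i j = \poly_(k < D) B' k i j.
    by apply: poly_eq_off0 => t t0; rewrite !horner_poly !entry H.
  by have := congr1 (fun p : {poly K} => p`_k) E; rewrite !coef_poly kD.
have QQ k l : (k < D)%N -> (l < D)%N -> Q k *m Q l = if k == l then Q k else 0.
  move=> kD lD; apply: (coef (fun l => Q k *m Q l) (fun l => if k == l then Q k else 0)) =>
    // t t0.
  rewrite (bigD1 (Ordinal kD)) //= [in RHS](bigD1 (Ordinal kD)) //= eqxx [X in _ = _ + X]big1;
    last first.
    by move=> h /negPf nh; rewrite eq_sym [_ == _]nh scaler0.
  rewrite addr0 -(bigD1 (Ordinal kD) (P := predT) (F := fun h : 'I_D =>
    t ^+ h *: (Q k *m Q h))) //=.
  apply: (coef (fun k => \sum_(h < D) t ^+ h *: (Q k *m Q h)) (fun k => t ^+ k *: Q k)) =>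
    // s s0.
  have := AM s t s0 t0; rewrite !EA ?mulf_neq0 // -scalemxAl -scalemxAr scalerA exprMn invfM.
  move/(scalerI (mulf_neq0 (invr_neq0 (expf_neq0 N s0)) (invr_neq0 (expf_neq0 N t0)))).
  rewrite mulmx_suml => E; transitivity (\sum_(k < D) (s * t) ^+ k *: Q k); last first.
    by apply: eq_bigr => h _; rewrite exprMn scalerA.
  rewrite E; apply: eq_bigr => h _; rewrite mulmx_sumr scaler_sumr; apply: eq_bigr => h' _.
  by rewrite -scalemxAl -scalemxAr.
have sumQ : \sum_(k < D) Q k = 1%:M.
  have <- : A 1 = 1%:M.
    have A1u : A 1 \in unitmx by rewrite unitmxE dA ?oner_neq0 // unitr1.
    rewrite -(mulmxK A1u (A 1)) -AM ?oner_neq0 // mulr1 mulmxV //.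
  rewrite EA ?oner_neq0 // expr1n invr1 scale1r.
  by apply: eq_bigr => k _; rewrite expr1n scale1r.
have [E Eu /allP/= Ediag] : codiagonalizable [seq Q k | k <- iota 0 D].
  apply/codiagonalizableP; split=> [B B'|B].
    move=> /mapP[k + ->] /mapP[l + ->]; rewrite !mem_iota !add0n /= => kD lD.
    by rewrite /comm_mx !QQ // eq_sym; case: eqP => // ->.
  move=> /mapP[k + ->]; rewrite mem_iota add0n /= => kD.
  by apply: idempotent_diagonalizable; rewrite QQ // eqxx.
have {Ediag}/fin_all_exists[d Hd] (k : 'I_D) : exists d : 'rV[K]_n.+1, E *m Q k = diag_mx d *m E.
  have /Ediag/diagonalizable_forPex[d /(simmxP Eu) Hd] : Q k \in [seq Q k | k <- iota 0 D].
    by apply: map_f; rewrite mem_iota add0n /=.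
  by exists d.
have dd k l i : d k ord0 i * d l ord0 i = if k == l then d k ord0 i else 0.
  have EE : diag_mx (d k) *m diag_mx (d l) = if k == l then diag_mx (d k) else 0.
    apply: (can_inj (mulmxK Eu)); rewrite -mulmxA -Hd mulmxA -Hd -mulmxA QQ //.
    by rewrite -[_ == _ :> nat]/(k == l); case: ifP => _; rewrite ?mulmx0 ?mul0mx.
  have := congr1 (fun M : 'M_n.+1 => M i i) EE; rewrite mulmx_diag !mxE eqxx mulr1n => ->.
  by case: ifP => _; rewrite !mxE ?eqxx.
have dsum i : \sum_k d k ord0 i = 1.
  have EE : \sum_k diag_mx (d k) = 1%:M.
    apply: (can_inj (mulmxK Eu)); rewrite mulmx_suml mul1mx -[RHS]mulmx1 -sumQ mulmx_sumr.
    by apply: eq_bigr => k _.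
  have := congr1 (fun M : 'M_n.+1 => M i i) EE; rewrite summxE !mxE eqxx => E1; apply: etrans E1.
  by apply: eq_bigr => k _; rewrite mxE eqxx.
(* On each diagonal position the projections give orthogonal idempotents of K with sum 1; one of
   them is 1, and its index is the weight before the shift by [N]. *)
have /fin_all_exists[w Hw] i : exists k, d k ord0 i = 1.
  have [k Hk] : exists k, d k ord0 i != 0.
    apply/existsP; apply: contra_eqT (dsum i); rewrite negb_exists => /forallP H.
    by rewrite big1 => [|k _]; [rewrite eq_sym oner_eq0|apply/eqP/negPn/H].
  by exists k; apply: (mulfI Hk); rewrite dd eqxx mulr1.
pose wt i : int := (nat_of_ord (w i))%:Z - N%:Z.
have EAt t : t != 0 -> E *m A t = diag_mx (\row_i t ^ wt i) *m E.
  move=> t0; rewrite EA // -scalemxAr mulmx_sumr.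
  under eq_bigr do rewrite -scalemxAr Hd scalemxAl.
  rewrite -mulmx_suml scalemxAl; congr (_ *m _); apply/matrixP => i j.
  rewrite !mxE summxE; under eq_bigr do rewrite !mxE.
  case: eqVneq => [->|ne]; last by rewrite mulr0n big1 ?mulr0 // => k _; rewrite mulr0n mulr0.
  rewrite mulr1n (bigD1 (w j)) //= big1 ?addr0 => [|k /negPf nk].
    by rewrite Hw mulr1n mulr1 mulrC /wt expfzDr // -exprnP exprnN.
  by rewrite mulr1n -[d k ord0 j]mulr1 -(Hw j) dd nk mulr0.
(* The determinant, equal to 1, is t to the power of the sum of the weights. *)
exists E, wt; split=> //; apply: expz_inj => t t0; rewrite expr0z.
have := congr1 determinant (EAt t t0); rewrite !det_mulmx dA // mulr1 det_diag.
rewrite -[LHS]mul1r => /mulIf E1.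
rewrite [RHS]E1; last by rewrite -unitfE -unitmxE.
elim/big_rec2: _ => [|i x y _ <-]; first by rewrite expr0z.
by rewrite expfzDr // mxE.
Qed.

End Weights.

(** * Coordinates adapted to both the equation and the action *)

Section Frame.
Variable K : closedFieldType.

Lemma bil_mxE m n (M : 'M[K]_(m, n)) x y : bil M x y = (x^T *m M *m y) ord0 ord0.
Proof.
rewrite /bil exchange_big mxE; apply: eq_bigr => j _; rewrite mxE mulr_suml.
by apply: eq_bigr => i _; rewrite mxE; ring.
Qed.

Lemma bil_mulmx m n m' n' (M : 'M[K]_(m, n)) (P : 'M_(m, m')) (Q : 'M_(n, n')) x y :
  bil M (P *m x) (Q *m y) = bil (P^T *m M *m Q) x y.
Proof. by rewrite !bil_mxE trmx_mul !mulmxA. Qed.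

Lemma unitmx_inj n (G : 'M[K]_n) : (forall x : 'cV_n, G *m x = 0 -> x = 0) -> G \in unitmx.
Proof.
move=> H; rewrite -unitmx_tr -row_free_unit -kermx_eq0; apply/eqP/row_matrixP => i.
rewrite row0; apply: (can_inj trmxK); rewrite trmx0; apply: H.
by apply: (can_inj trmxK); rewrite trmx_mul !trmxK -row_mul mulmx_ker row0 trmx0.
Qed.

(* The change of coordinates x |-> (sum_i c_i x_i, (x_i)_(i <> i0)). *)
Definition pivot_mx n (c : 'I_n.+1 -> K) (i0 : 'I_n.+1) : 'M[K]_n.+1 :=
  \matrix_(k, i) if unlift ord0 k is Some k' then (i == lift i0 k')%:R else c i.

Lemma pivot_mx0 n c i0 (x : 'cV[K]_n.+1) :
  (pivot_mx c i0 *m x) ord0 ord0 = \sum_i c i * x i ord0.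
Proof. by rewrite mxE; apply: eq_bigr => i _; rewrite mxE unlift_none. Qed.

Lemma pivot_mxS n c i0 (x : 'cV[K]_n.+1) k :
  (pivot_mx c i0 *m x) (lift ord0 k) ord0 = x (lift i0 k) ord0.
Proof.
rewrite mxE (bigD1 (lift i0 k)) //= mxE liftK eqxx mul1r big1 ?addr0 // => i /negPf ne.
by rewrite mxE liftK ne mul0r.
Qed.

Lemma pivot_mx_unit n (c : 'I_n.+1 -> K) i0 : c i0 != 0 -> pivot_mx c i0 \in unitmx.
Proof.
move=> c0; apply: unitmx_inj => x E.
have xl k : x (lift i0 k) ord0 = 0 by rewrite -(pivot_mxS c) E mxE.
apply/colP => i; rewrite mxE; case: (unliftP i0 i) => [k ->|->]; first exact: xl.
have := pivot_mx0 c i0 x; rewrite E mxE (bigD1_ord i0) //= big1 ?addr0 => [|k _];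
  last by rewrite xl mulr0.
by move/esym/eqP; rewrite mulf_eq0 (negPf c0) => /eqP.
Qed.

Definition pivot_weight n (w : 'I_n.+1 -> int) (i0 k : 'I_n.+1) : int :=
  if unlift ord0 k is Some k' then w (lift i0 k') else w i0.

Lemma sum_pivot_weight n (w : 'I_n.+1 -> int) i0 : \sum_k pivot_weight w i0 k = \sum_i w i.
Proof.
rewrite big_ord_recl (bigD1_ord i0) //= /pivot_weight unlift_none; congr (_ + _).
by apply: eq_bigr => k _; rewrite liftK.
Qed.

(** The new first coordinate combines coordinates of a single weight only, so it is again a weight
    vector. *)
Lemma pivot_mx_diag n c (w : 'I_n.+1 -> int) i0 (t : K) :
  (forall i, c i != 0 -> w i = w i0) ->
  pivot_mx c i0 *m diag_mx (\row_i t ^ w i) = diag_mx (\row_k t ^ pivot_weight w i0 k) *m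
    pivot_mx c i0.
Proof.
move=> H; apply/matrixP => k i; rewrite mul_mx_diag mul_diag_mx !mxE /pivot_weight.
case: (unliftP ord0 k) => [k' _|_].
  by case: eqP => [->|]; rewrite ?mul1r ?mulr1 ?mul0r ?mulr0.
by have [->|/H->] := eqVneq (c i) 0; rewrite ?mul0r ?mulr0 // mulrC.
Qed.

(** One step of Gaussian elimination on the pivot (i0, j0): the pivot column and the normalized
    pivot row give the two new linear forms, and [C] is the Schur complement. *)
Lemma bil_pivot m n (M : 'M[K]_(m.+1, n.+1)) i0 j0 : M i0 j0 != 0 ->
  exists C : 'M[K]_(m, n), forall x y,
    let x' := pivot_mx (M^~ j0) i0 *m x in
    let y' := pivot_mx (fun j => M i0 j / M i0 j0) j0 *m y in
    bil M x y = x' ord0 ord0 * y' ord0 ord0 + bil C (vtail x') (vtail y').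
Proof.
move=> M0; exists (\matrix_(k, l) (M (lift i0 k) (lift j0 l) - M (lift i0 k) j0 * M i0 (lift j0
  l) / M i0 j0)).
move=> x y x' y'; rewrite /x' /y' !pivot_mx0.
have -> : bil (\matrix_(k, l) (M (lift i0 k) (lift j0 l) - M (lift i0 k) j0 * M i0 (lift j0 l) /
  M i0 j0))
            (vtail x') (vtail y') =
  \sum_k \sum_l M (lift i0 k) (lift j0 l) * x (lift i0 k) ord0 * y (lift j0 l) ord0 -
  (\sum_k M (lift i0 k) j0 * x (lift i0 k) ord0) * (\sum_l M i0 (lift j0 l) * y (lift j0 l)
    ord0) / M i0 j0.
  rewrite !mulr_suml -sumrB; apply: eq_bigr => k _; rewrite mulr_sumr mulr_suml -sumrB.
  by apply: eq_bigr => l _; rewrite !vtailE !pivot_mxS !mxE; ring.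
rewrite /bil (bigD1_ord i0) //= (bigD1_ord j0) //=.
under [\sum_(i < m) \sum_j _]eq_bigr do rewrite (bigD1_ord j0) //=.
rewrite big_split /= [\sum_i M i j0 * _](bigD1_ord i0) //= [\sum_j M i0 j / _ * _](bigD1_ord j0)
  //=.
set X := \sum_(i < m) M (lift i0 i) j0 * x (lift i0 i) ord0.
set Y := \sum_l M i0 (lift j0 l) * y (lift j0 l) ord0.
have -> : \sum_(i < n) M i0 (lift j0 i) * x i0 ord0 * y (lift j0 i) ord0 = x i0 ord0 * Y.
  by rewrite mulr_sumr; apply: eq_bigr => l _; ring.
have -> : \sum_(i < m) M (lift i0 i) j0 * x (lift i0 i) ord0 * y j0 ord0 = X * y j0 ord0.
  by rewrite mulr_suml.
have -> : \sum_(i < n) M i0 (lift j0 i) / M i0 j0 * y (lift j0 i) ord0 = Y / M i0 j0.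
  by rewrite mulr_suml; apply: eq_bigr => l _; ring.
by field.
Qed.

(** Once lambda is diagonal, semi-invariance forces p i + q j = - alpha for all x_i y_j occurring in
    f. All entries of the pivot column thus have the same weight, likewise for the pivot row, so
    elimination keeps lambda diagonal. The sign arises because [p] and [q] describe lambda(t) on
    vectors, while polynomials carry the dual action. *)
Lemma weight_frame m n (f : {mpoly K[m.+1 + n.+1]}) (lam : one_ps K m n) alpha :
  bihomog 1 1 f -> prime_poly f -> has_weight lam f alpha ->
  exists (E : 'M[K]_m.+1) (F : 'M[K]_n.+1) (p : 'I_m.+1 -> int) (q : 'I_n.+1 ->
    int) (C : 'M[K]_(m, n)),
  [/\ E \in unitmx /\ F \in unitmx,
      \sum_i p i = 0 /\ \sum_j q j = 0,
      (forall t, t != 0 -> E *m psx lam t = diag_mx (\row_i t ^ p i) *m E) /\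
      (forall t, t != 0 -> F *m psy lam t = diag_mx (\row_j t ^ q j) *m F),
      p ord0 + q ord0 = - alpha
    & C != 0 /\ forall x y, on_hypersurface f x y <-> on_quadric C (E *m x) (F *m y)].
Proof.
move=> Hf prf wf.
have [E [p [Eu p0 HE]]] := one_ps_diagonalizable (psx_laurent lam) (psx_det lam) (psxM lam).
have [F [q [Fu q0 HF]]] := one_ps_diagonalizable (psy_laurent lam) (psy_det lam) (psyM lam).
have [M0 HM0] := bihomog11_bil Hf.
pose M := (invmx E)^T *m M0 *m invmx F.
have HM x y : f.@[Defs.coord x y] = bil M (E *m x) (F *m y).
  by rewrite -bil_mulmx !mulKmx // HM0.
have wM i j : M i j != 0 -> p i + q j = - alpha.
  move=> Mij; apply/eqP; rewrite -addr_eq0; apply/eqP; apply: expz_inj => t t0.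
  have Au : psx lam t \in unitmx by rewrite unitmxE psx_det // unitr1.
  have Bu : psy lam t \in unitmx by rewrite unitmxE psy_det // unitr1.
  pose x : 'cV[K]_m.+1 := invmx E *m delta_mx i ord0.
  pose y : 'cV[K]_n.+1 := invmx F *m delta_mx j ord0.
  have := wf t t0 (psx lam t *m x) (psy lam t *m y).
  rewrite !mulKmx // !HM !mulmxA HE // HF // -!mulmxA !mulKVmx //.
  have diag_delta k (w : 'I_k -> int) h :
      diag_mx (\row_i t ^ w i) *m (delta_mx h ord0 : 'cV[K]_k) = t ^ w h *: delta_mx h ord0.
    apply/colP => l; rewrite mul_diag_mx !mxE; case: eqP => [->|] //=.
    by rewrite !mulr0.
  rewrite !diag_delta bilZl bilZr bil_delta => E1.
  apply/esym; rewrite expr0z; apply: (mulIf Mij); rewrite mul1r {1}E1.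
  by rewrite !expfzDr //; ring.
have /matrix0Pn[i0 [j0 Mij]] : M != 0.
  case: prf => f0 _ _; apply: contraNneq f0 => M00; apply/eqP/meval_coord_ext => x y.
  rewrite HM M00 meval0 /bil big1 // => i _; rewrite big1 // => j _.
  by rewrite mxE !mul0r.
have [C HC] := bil_pivot Mij.
pose G := pivot_mx (M^~ j0) i0; pose H := pivot_mx (fun j => M i0 j / M i0 j0) j0.
have Gu : G \in unitmx by apply: pivot_mx_unit.
have Hu : H \in unitmx by apply: pivot_mx_unit; rewrite divff ?oner_neq0.
have wp i : M i j0 != 0 -> p i = p i0.
  by move=> Mi; apply: (addIr (q j0)); rewrite !wM.
have wq j : M i0 j / M i0 j0 != 0 -> q j = q j0.
  by rewrite mulf_eq0 negb_or => /andP[Mj _]; apply: (addrI (p i0)); rewrite !wM.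
have f_frame x y : f.@[Defs.coord x y] =
    ((G *m E) *m x) ord0 ord0 * ((H *m F) *m y) ord0 ord0 +
    bil C (vtail ((G *m E) *m x)) (vtail ((H *m F) *m y)).
  by rewrite HM HC -!mulmxA.
have GEu : G *m E \in unitmx by rewrite unitmx_mul Gu.
have HFu : H *m F \in unitmx by rewrite unitmx_mul Hu.
exists (G *m E), (H *m F), (pivot_weight p i0), (pivot_weight q j0), C; split.
- by [].
- by rewrite !sum_pivot_weight.
- split=> t t0; first by rewrite -mulmxA HE // !mulmxA pivot_mx_diag.
  by rewrite -mulmxA HF // !mulmxA pivot_mx_diag.
- by rewrite /pivot_weight !unlift_none wM.
have mul_eq0 k (A : 'M[K]_k) (z : 'cV[K]_k) : A \in unitmx -> (A *m z == 0) = (z == 0).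
  by move=> Au; apply/eqP/eqP => [Az|->]; [rewrite -(mulKmx Au z) Az mulmx0|rewrite mulmx0].
split; last by move=> x y; rewrite /on_hypersurface /on_quadric !mul_eq0 // f_frame.
apply/eqP => C0; apply: (prime_bil_not_rank1 Hf prf GEu HFu) => x y.
rewrite f_frame C0 [bil _ _ _]big1 ?addr0 // => i _; rewrite big1 // => j _.
by rewrite mxE !mul0r.
Qed.

End Frame.

(** * Weight bases of the spaces of sections, and linearizations *)

Section WeightBasis.
Variable K : closedFieldType.
Hypothesis charK : [pchar K] =i pred0.
Variables (m n : nat) (f : {mpoly K[m.+2 + n.+2]}).
Hypothesis Hf : bihomog 1 1 f.
Variables (E : 'M[K]_m.+2) (F : 'M[K]_n.+2) (C : 'M[K]_(m.+1, n.+1)).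
Hypotheses (Eu : E \in unitmx) (Fu : F \in unitmx) (C0 : C != 0).
Hypothesis frame : forall x y, on_hypersurface f x y <-> on_quadric C (E *m x) (F *m y).

Let basis_fun (p : 'X_{1..m.+2} * 'X_{1..n.+2}) (P : point K m.+1 n.+1) : K :=
  bimono p (E *m px P) (F *m py P).

(** The set [Z] need only contain the fiber over [t]: the lemma serves both for the central fiber
    and for the product of X with the punctured line. *)
Lemma fiber_section_spanned Z a b s t :
  (forall x y, on_hypersurface f x y -> Z (Point x y t)) -> regular_section Z a b s ->
  exists c, forall x y, on_hypersurface f x y ->
    s (Point x y t) = \sum_(p <- normal_monos m.+1 n.+1 a b) c p * basis_fun p (Point x y t).
Proof.
move=> HZ /(regular_section_fiber Hf HZ) sec.
have sec' : is_section (on_quadric C) a b (fun x y => s (Point (invmx E *m x) (invmx F *m y) t)).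
  apply: (is_section_linear _ sec) => x y Zxy; apply/frame.
  by rewrite !mulKVmx.
have [c Hc] := section_spanned charK C0 sec'.
by exists c => x y /frame/Hc; rewrite !mulKmx // => ->.
Qed.

Lemma hypersurface_point : exists x y, on_hypersurface f x y.
Proof.
exists (invmx E *m vcons 1 0), (invmx F *m vcons 0 (const_mx 1)); apply/frame.
rewrite !mulKVmx //; apply/on_quadric_cons; split; rewrite ?oner_eq0 //.
  by rewrite eqxx /=; apply/negP => /eqP/colP/(_ ord0)/eqP; rewrite !mxE oner_eq0.
by rewrite bil0l mulr0 addr0.
Qed.

(** On each fiber [phi] is a section of O(0, 0), hence constant, since the only normal monomial of
    bidegree (0, 0) is 1. By the cocycle condition it becomes a multiplicative function of t; being
    rational without zeros or poles for t <> 0, it is a power of t. *)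
Lemma linearization_character (lam : one_ps K m.+1 n.+1) phi :
  preserves lam f -> linearization f lam phi ->
  exists c : int, forall t x y, t != 0 -> on_hypersurface f x y -> phi t x y = t ^ c.
Proof.
move=> pres [reg phi1 phiM].
have [x0 [y0 H0]] := hypersurface_point.
have const t x y : t != 0 -> on_hypersurface f x y -> phi t x y = phi t x0 y0.
  move=> t0 Hxy; have [|c Hc] := @fiber_section_spanned _ _ _ _ t _ reg; first by [].
  rewrite (Hc x y) // (Hc x0 y0) // big_seq [RHS]big_seq; apply: eq_bigr => p.
  rewrite mem_normal_monos !mdeg_eq0 /basis_fun => /and3P[_ /eqP Ep1 /eqP Ep2]; congr (_ * _).
  by rewrite /bimono Ep1 Ep2 /mono !big1 // => i _; rewrite mnm0E expr0.
pose chi t := phi t x0 y0.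
have chi1 : chi 1 = 1 by apply: phi1.
have Hinv t : t != 0 -> psx lam t^-1 = invmx (psx lam t) /\ psy lam t^-1 = invmx (psy lam t).
  move=> t0; have Au : psx lam t \in unitmx by rewrite unitmxE psx_det // unitr1.
  have Bu : psy lam t \in unitmx by rewrite unitmxE psy_det // unitr1.
  have A1 : psx lam 1 = 1%:M.
    have A1u : psx lam 1 \in unitmx by rewrite unitmxE psx_det ?oner_neq0 // unitr1.
    by rewrite -(mulmxK A1u (psx lam 1)) -psxM ?oner_neq0 // mulr1 mulmxV.
  have B1 : psy lam 1 = 1%:M.
    have B1u : psy lam 1 \in unitmx by rewrite unitmxE psy_det ?oner_neq0 // unitr1.
    by rewrite -(mulmxK B1u (psy lam 1)) -psyM ?oner_neq0 // mulr1 mulmxV.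
  split.
    by rewrite -[RHS]mulmx1 -A1 -(mulfV t0) psxM ?invr_eq0 // mulKmx.
  by rewrite -[RHS]mulmx1 -B1 -(mulfV t0) psyM ?invr_eq0 // mulKmx.
have chiM s t : s != 0 -> t != 0 -> chi (s * t) = chi s * chi t.
  move=> s0 t0; rewrite /chi phiM //; congr (_ * _); apply: const => //.
  by have [<- <-] := Hinv s s0; apply: pres; rewrite ?invr_eq0.
have chi0 t : t != 0 -> chi t != 0.
  move=> t0; apply/negP => /eqP Et; have := chiM t t^-1 t0;
    rewrite mulfV // chi1 Et mul0r invr_eq0 => /(_ t0)/eqP.
  by rewrite oner_eq0.
have [||p [q Hpq]] := @locally_rational_global K 'X chi; first by rewrite polyX_eq0.
  move=> t; rewrite hornerX => t0.
  have [i [j [p [q [_ _ qP Hpq]]]]] := reg (Point x0 y0 t) (conj H0 t0).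
  exists p.@[fun i => (Defs.coord x0 y0 i)%:P], q.@[fun i => (Defs.coord x0 y0 i)%:P].
  by split=> // t'; rewrite hornerX => t'0 qt'; have := Hpq (Point x0 y0 t') (conj H0 t'0) qt'.
have {}Hpq t : t != 0 -> q.[t] != 0 /\ chi t = p.[t] / q.[t].
  by move=> t0; apply: Hpq; rewrite hornerX.
have [q1 chi1E] := Hpq 1 (oner_neq0 _).
have q0 : q != 0 by apply: contraNneq q1 => ->; rewrite horner0.
have p1 : p.[1] != 0.
  by apply/negP => /eqP p1; move: chi1E; rewrite chi1 p1 mul0r => /eqP; rewrite oner_eq0.
have p0 : p != 0 by apply: contraNneq p1 => ->; rewrite horner0.
have [k [d [d0 Ep]]] : exists k d, d != 0 /\ p = d *: 'X^k.
  apply: poly_root_only0 => // t t0; apply/negP => /eqP pt; have := chi0 t t0.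
  by have [_ ->] := Hpq t t0; rewrite pt mul0r eqxx.
have [l [e [e0 Eq]]] : exists k d, d != 0 /\ q = d *: 'X^k.
  by apply: poly_root_only0 => // t /Hpq[].
have de : d = e.
  move: chi1E; rewrite chi1 Ep Eq !hornerZ !hornerXn !expr1n !mulr1 => /esym/divr1_eq.
  by [].
exists (k%:Z - l%:Z) => t x y t0 Hxy; rewrite const // -/(chi t).
have [_ ->] := Hpq t t0; rewrite Ep Eq de !hornerZ !hornerXn expfzDr // -exprnP -exprnN.
by field; rewrite e0 expf_neq0.
Qed.

Lemma normal_monos_basis Z a b t :
  (forall P, Z P <-> on_hypersurface f (px P) (py P) /\ ptau P = t) ->
  basis_on Z (regular_section Z a b)
    (fun i => basis_fun (tnth (in_tuple (normal_monos m.+1 n.+1 a b)) i)).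
Proof.
set L := normal_monos _ _ _ _ => HZ; split=> [i|c Hc i|s Hs].
- have := mem_tnth i (in_tuple L); rewrite mem_normal_monos => /and3P[_ /eqP Ha /eqP Hb].
  by rewrite -Ha -Hb; move: (tnth _ _) => [mu mv]; apply: bimono_regular.
(* The coefficients, indexed by positions, are transported to monomials; this is well defined
   because the list has no repetitions. *)
- pose c' p := oapp c 0 (insub (index p L) : option 'I_(size L)).
  have c'E j : c' (tnth (in_tuple L) j) = c j.
    rewrite /c' (tnth_nth (tnth (in_tuple L) j)) index_uniq ?normal_monos_uniq // valK.
    by [].
  rewrite -c'E; apply: (normal_monos_free C0 (c := c')); last exact: (mem_tnth i (in_tuple L)).
  move=> x y Zxy; rewrite big_tnth -[RHS](Hc (Point (invmx E *m x) (invmx F *m y) t)); last first.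
    by apply/HZ; split=> //; apply/frame; rewrite /= !mulKVmx.
  by apply: eq_bigr => j _; rewrite c'E /basis_fun /= !mulKVmx.
have [|c Hc] := fiber_section_spanned (t := t) _ Hs; first by move=> x y Hxy; apply/HZ.
exists (fun i => c (tnth (in_tuple L) i)) => -[x y t'] /HZ[/= Hxy ->].
by rewrite Hc // -/L [LHS]big_tnth.
Qed.

Lemma mono_diag k (w : 'I_k -> int) (mu : 'X_{1..k}) (t : K) (v : 'cV[K]_k) : t != 0 ->
  mono mu (diag_mx (\row_i t ^ w i) *m v) = t ^ (\sum_i w i * (mu i)%:Z) * mono mu v.
Proof.
move=> t0; rewrite /mono.
have -> : t ^ (\sum_i w i * (mu i)%:Z) = \prod_i (t ^ w i) ^+ mu i.
  elim/big_rec2: _ => [|i x y _ <-]; first by rewrite expr0z.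
  by rewrite expfzDr // exprnP exprz_exp.
rewrite -big_split; apply: eq_bigr => i _.
by rewrite mul_diag_mx !mxE exprMn.
Qed.

Lemma basis_fun_weight (lam : one_ps K m.+1 n.+1) (p : 'I_m.+2 -> int) (q : 'I_n.+2 ->
  int) l t P :
  (forall t, t != 0 -> E *m psx lam t = diag_mx (\row_i t ^ p i) *m E) ->
  (forall t, t != 0 -> F *m psy lam t = diag_mx (\row_j t ^ q j) *m F) ->
  t != 0 ->
  basis_fun l (Point (psx lam t^-1 *m px P) (psy lam t^-1 *m py P) (t^-1 * ptau P)) =
  t ^ (- (\sum_i p i * (l.1 i)%:Z + \sum_j q j * (l.2 j)%:Z)) * basis_fun l P.
Proof.
move=> HE HF t0; have t1 : t^-1 != 0 by rewrite invr_eq0.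
rewrite /basis_fun /bimono /= !mulmxA HE // HF // -!mulmxA !mono_diag // mulrACA -expfzDr //.
by rewrite exprz_inv.
Qed.

End WeightBasis.

(** * Dimensions and weights *)

Section Counting.

Lemma big_monos_pos (V : nmodType) n a (G : 'X_{1..n.+1} -> V) :
  \sum_(m <- monos n.+1 a.+1 | m ord0 != 0%N) G m =
  \sum_(m <- monos n.+1 a) G (U_(ord0) + m)%MM.
Proof.
rewrite -big_filter -(big_map (fun m => (U_(ord0) + m)%MM) predT G); apply: perm_big.
apply: uniq_perm; first by rewrite filter_uniq ?monos_uniq.
  by rewrite map_inj_uniq ?monos_uniq //; apply: addmI.
move=> m; rewrite mem_filter mem_monos; apply/andP/mapP => [[m0 /eqP dm]|[m' + ->]].
  have Em : m = (U_(ord0) + (m - U_(ord0)))%MM by rewrite addmC submK // lep1mP.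
  exists (m - U_(ord0))%MM => //; rewrite mem_monos -eqSS -dm [in X in _ == mdeg X]Em mdegD mdeg1.
  by [].
by rewrite mem_monos => /eqP<-; rewrite mdegD mdeg1 mnmDE mnm1E eqxx.
Qed.

(** The excluded monomials are exactly x_0 y_0 times those of bidegree (a, b). *)
Lemma big_normal_monos (V : zmodType) m n a b (G : 'X_{1..m.+1} * 'X_{1..n.+1} -> V) :
  \sum_(p <- normal_monos m n a.+1 b.+1) G p =
  \sum_(mu <- monos m.+1 a.+1) \sum_(mv <- monos n.+1 b.+1) G (mu, mv) -
  \sum_(mu <- monos m.+1 a) \sum_(mv <- monos n.+1 b) G (U_(ord0) + mu, U_(ord0) + mv)%MM.
Proof.
rewrite big_filter -big_allpairs [X in _ = X - _](bigID (fun p : 'X_{1..m.+1} * 'X_{1..n.+1} =>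
  (p.1 ord0 == 0%N) || (p.2 ord0 == 0%N))) /= -addrA -[LHS]addr0; congr (_ + _).
apply/esym/eqP; rewrite subr_eq0; apply/eqP.
rewrite -(big_monos_pos a (fun mu : 'X_{1..m.+1} =>
  \sum_(mv <- monos n.+1 b) G (mu, (U_(ord0) + mv)%MM))).
under [RHS]eq_bigr do rewrite -(big_monos_pos b (fun mv : 'X_{1..n.+1} => G (_, mv))).
rewrite [RHS]big_mkcond; under [RHS]eq_bigr do rewrite big_mkcond.
rewrite [LHS]big_mkcond big_allpairs; apply: eq_bigr => mu _.
case: eqP => _ /=; last by apply: eq_bigr.
by rewrite big1.
Qed.

(* By symmetry all the variables have the same total exponent. *)
Lemma sum_monos_weight n a (w : 'I_n.+1 -> int) : \sum_i w i = 0 ->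
  \sum_(m <- monos n.+1 a) \sum_i w i * (m i)%:Z = 0.
Proof.
move=> w0; rewrite exchange_big /=.
have sym i : \sum_(m <- monos n.+1 a) (m i)%:Z = \sum_(m <- monos n.+1 a) (m ord0)%:Z :> int.
  pose s := tperm ord0 i.
  pose h (m : 'X_{1..n.+1}) := [multinom m (s j) | j < n.+1].
  have hK : involutive h by move=> m; apply/mnmP => j; rewrite !mnmE tpermK.
  have ph : perm_eq (monos n.+1 a) [seq h m | m <- monos n.+1 a].
    apply: uniq_perm; rewrite ?(map_inj_uniq (inv_inj hK)) ?monos_uniq // => m.
    rewrite -[in RHS](hK m) (mem_map (inv_inj hK)) !mem_monos; congr (_ == _).
    by rewrite /h mdeg_mperm.
  rewrite (perm_big _ ph) big_map; apply: eq_bigr => m _.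
  by rewrite mnmE tpermR.
under eq_bigr do rewrite -mulr_sumr sym.
by rewrite -mulr_suml w0 mul0r.
Qed.

Lemma sumr_const_seq (R : pzSemiRingType) (I : Type) (r : seq I) (c : R) :
  \sum_(i <- r) c = (size r)%:R * c.
Proof. by elim: r => [|i r IH]; rewrite ?big_nil ?mul0r // big_cons IH /= -natr1 mulrDl mul1r
  addrC. Qed.

Lemma size_normal_monos m n a b :
  (size (normal_monos m n a.+1 b.+1))%:R =
  ('C(a.+1 + m, a.+1) * 'C(b.+1 + n, b.+1))%:R - ('C(a + m, a) * 'C(b + n, b))%:R :> int.
Proof.
rewrite -!size_monos -[LHS]mulr1 -sumr_const_seq big_normal_monos.
rewrite !(sumr_const_seq (monos n.+1 _)) !mulr1 !sumr_const_seq.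
by rewrite !natrM.
Qed.

Lemma total_weight_normal_monos m n a b (p : 'I_m.+1 -> int) (q : 'I_n.+1 -> int) :
  \sum_i p i = 0 -> \sum_j q j = 0 ->
  \sum_(l <- normal_monos m n a.+1 b.+1) (\sum_i p i * (l.1 i)%:Z + \sum_j q j * (l.2 j)%:Z) =
  - (p ord0 + q ord0) * ('C(a + m, a) * 'C(b + n, b))%:R.
Proof.
move=> p0 q0; rewrite big_normal_monos /=.
have tot c d : \sum_(mu <- monos m.+1 c) \sum_(mv <- monos n.+1 d)
    (\sum_i p i * (mu i)%:Z + \sum_j q j * (mv j)%:Z) = 0.
  under eq_bigr do rewrite big_split /= sumr_const_seq sum_monos_weight // addr0.
  by rewrite -mulr_sumr sum_monos_weight // mulr0.
have shift k (w : 'I_k.+1 -> int) (mu : 'X_{1..k.+1}) :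
    \sum_i w i * ((U_(ord0) + mu)%MM i)%:Z = w ord0 + \sum_i w i * (mu i)%:Z.
  rewrite [LHS](eq_bigr (fun i => w i * (U_(ord0)%MM i)%:Z + w i * (mu i)%:Z)); last first.
    by move=> i _; rewrite mnmDE PoszD mulrDr.
  rewrite big_split /= (bigD1 ord0) //= mnm1E eqxx mulr1 big1 ?addr0 // => i /negPf ne.
  by rewrite mnm1E eq_sym ne mulr0.
rewrite tot sub0r; under eq_bigr do under eq_bigr do rewrite !shift addrACA.
under eq_bigr do rewrite big_split /= sumr_const_seq.
rewrite big_split /= tot addr0 sumr_const_seq -!size_monos natrM; ring.
Qed.

End Counting.

(** * The polynomials N_k and w_k, and their leading coefficients *)

Section HilbertPolynomial.

Lemma rising_ffact a m : ((a + m) ^_ m = \prod_(i < m) (a + i.+1))%N.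
Proof.
rewrite ffact_prod (reindex_inj rev_ord_inj) /=; apply: eq_bigr => i _.
by have := ltn_ord i; lia.
Qed.

(* 'C(d k - 1 + (m + 1), m + 1) / (d k), as a polynomial in k. *)
Definition bin_poly m (d : nat) : {poly rat} :=
  (m.+1)`!%:R^-1 *: \prod_(i < m) (d%:R *: 'X + (i.+1)%:R%:P).

(** With a = d k - 1, the numerator (a + 1) ... (a + m + 1) of the binomial coefficient starts with
    d k, which is the factor taken out. *)
Lemma bin_polyE m d k : (0 < d * k)%N ->
  'C((d * k).-1 + m.+1, (d * k).-1)%:R = (d * k)%:R * (bin_poly m d).[k%:R] :> rat.
Proof.
move=> dk; set a := (d * k).-1; have Ea : (d * k = a.+1)%N by rewrite prednK.
have f0 : (m.+1)`!%:R != 0 :> rat by rewrite Num.Theory.pnatr_eq0 -lt0n fact_gt0.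
apply: (mulIf f0); rewrite -natrM -bin_sub ?leq_addr // addKn bin_ffact rising_ffact.
rewrite hornerZ horner_prod big_ord_recl addn1 -Ea natrM -mulrA; congr (_ * _).
rewrite mulrC mulVKf // natr_prod; apply: eq_bigr => i _.
rewrite hornerD hornerZ hornerX hornerC -natrM -natrD Ea lift0; congr (_%:R).
by lia.
Qed.

Lemma size_bin_poly m d : (0 < d)%N -> size (bin_poly m d) = m.+1.
Proof.
move=> d0; rewrite size_scale; last by rewrite invr_eq0 Num.Theory.pnatr_eq0 -lt0n fact_gt0.
have d1 : d%:R != 0 :> rat by rewrite Num.Theory.pnatr_eq0 -lt0n.
have s2 (i : 'I_m) : size (d%:R *: 'X + (i.+1)%:R%:P : {poly rat}) = 2.
  by rewrite size_addl size_scale ?size_polyX // size_polyC; case: eqP.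
rewrite size_prod => [|i _]; last by rewrite -size_poly_gt0 s2.
by rewrite (eq_bigr _ (fun i _ => s2 i)) sum_nat_const card_ord; lia.
Qed.

Section DonaldsonFutaki.
Variables (m n d e : nat).
Hypotheses (d_gt0 : (0 < d)%N) (e_gt0 : (0 < e)%N).

Let dQ : d%:R != 0 :> rat. Proof. by rewrite Num.Theory.pnatr_eq0 -lt0n. Qed.
Let eQ : e%:R != 0 :> rat. Proof. by rewrite Num.Theory.pnatr_eq0 -lt0n. Qed.

(* h^0(O(d k - 1, e k - 1)) on P^(m+1) x P^(n+1) is k^2 times this polynomial. *)
Definition ideal_poly : {poly rat} := (d * e)%:R *: (bin_poly m d * bin_poly n e).

(** The first factor is k^2 ((1 + (m + 1)/(dk)) (1 + (n + 1)/(ek)) - 1) / k^2 times k^2, that is,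
    the ratio of consecutive dimensions minus 1, cleared of its denominator k^2. *)
Definition hilbert_poly : {poly rat} :=
  (((m.+1)%:R / d%:R + (n.+1)%:R / e%:R) *: 'X + ((m.+1 * n.+1)%:R / (d * e)%:R)%:P) * ideal_poly.

Lemma size_ideal_poly : size ideal_poly = (m + n).+1.
Proof.
rewrite size_scale; last by rewrite natrM mulf_neq0.
by rewrite size_mul -?size_poly_gt0 ?size_bin_poly //; lia.
Qed.

Lemma ideal_polyE k : (0 < k)%N ->
  ('C((d * k).-1 + m.+1, (d * k).-1) * 'C((e * k).-1 + n.+1, (e * k).-1))%:R
    = k%:R ^+ 2 * ideal_poly.[k%:R].
Proof.
move=> k0; rewrite natrM !bin_polyE ?muln_gt0 ?d_gt0 ?e_gt0 //.
by rewrite /ideal_poly hornerZ hornerM !natrM; ring.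
Qed.

Lemma hilbert_polyE k : (0 < k)%N ->
  ('C(d * k + m.+1, d * k) * 'C(e * k + n.+1, e * k))%:R
   - ('C((d * k).-1 + m.+1, (d * k).-1) * 'C((e * k).-1 + n.+1, (e * k).-1))%:R
    = hilbert_poly.[k%:R].
Proof.
move=> k0; have kQ : k%:R != 0 :> rat by rewrite Num.Theory.pnatr_eq0 -lt0n.
have rec m' d' : (0 < d')%N ->
    'C(d' * k + m'.+1, d' * k)%:R = 'C((d' * k).-1 + m'.+1, (d' * k).-1)%:R * (((d' * k)%:R +
      (m'.+1)%:R) / (d' * k)%:R) :> rat.
  move=> d'0; have dk : (0 < d' * k)%N by rewrite muln_gt0 d'0.
  have dkQ : (d' * k)%:R != 0 :> rat by rewrite Num.Theory.pnatr_eq0 -lt0n.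
  apply: (mulfI dkQ).
  transitivity ('C((d' * k).-1 + m'.+1, (d' * k).-1)%:R * ((d' * k)%:R + (m'.+1)%:R) : rat).
    2: by rewrite [RHS]mulrCA [(d' * k)%:R * (_ / _)]mulrC divfK.
  rewrite -natrD -!natrM; congr (_%:R).
  move: dk; case: (d' * k)%N => // a _ /=.
  by have := mul_bin_diag (a.+1 + m'.+1) a; rewrite addSn /= => <-; rewrite mulnC.
rewrite !natrM !rec // -!natrM mulrACA -natrM ideal_polyE // /hilbert_poly hornerM.
move: ideal_poly.[_] => J; rewrite hornerD hornerZ hornerX hornerC !natrM.
by field; rewrite dQ eQ kQ.
Qed.

(** With T = X I, one has A = c1 T + c0 I and B = X (g A - al T). The part g A cancels in a1 b0 - a0
    b1, and so does the subleading coefficient of I; what remains is - al c0 mu0^2, to be divided by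
    (c1 mu0)^2. *)
Lemma donaldson_futaki_coefs (g al : rat) (N := (m + n).+1) :
  let A := hilbert_poly in
  let B := g *: ('X * A) - al *: ('X^2 * ideal_poly) in
  [/\ (size A <= N.+1)%N, (size B <= N.+2)%N, A`_N != 0
    & 2 * ((A`_N.-1 * B`_N.+1 - A`_N * B`_N) / A`_N ^+ 2) =
      - ((2 * (m.+1)%:R * (n.+1)%:R * d%:R * e%:R) / ((m.+1)%:R * e%:R + (n.+1)%:R * d%:R) ^+ 2)
          * al].
Proof.
move=> A B; pose T := 'X * ideal_poly.
pose c1 : rat := (m.+1)%:R / d%:R + (n.+1)%:R / e%:R.
pose c0 : rat := (m.+1 * n.+1)%:R / (d * e)%:R.
have EA : A = c1 *: T + c0 *: ideal_poly.
  by rewrite /A /hilbert_poly mulrDl -scalerAl mul_polyC.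
have EB : B = 'X * (g *: A - al *: T).
  by rewrite /B /T mulrBr -!scalerAr (mulrA 'X 'X) -expr2.
have sI := size_ideal_poly.
clearbody A B; set I := ideal_poly in T sI EA EB *; clearbody I.
have I0 : I != 0 by rewrite -size_poly_gt0 sI.
have sT : size T = N.+1 by rewrite /T mulrC size_mulX // sI.
have sA : (size A <= N.+1)%N.
  rewrite EA (leq_trans (size_polyD _ _)) // geq_max.
  by apply/andP; split; apply: leq_trans (size_scale_leq _ _) _; rewrite ?sT ?sI.
have sB : (size B <= N.+2)%N.
  rewrite EB; have [->|nz] := eqVneq (g *: A - al *: T) 0; first by rewrite mulr0 size_poly0.
  rewrite mulrC size_mulX // ltnS (leq_trans (size_polyD _ _)) // size_polyN geq_max.
  by apply/andP; split; apply: leq_trans (size_scale_leq _ _) _; rewrite ?sT.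
pose mu0 := I`_(m + n); pose mu1 := T`_(m + n).
have mu0n : mu0 != 0.
  by rewrite /mu0 -[(m + n)%N]/((m + n).+1.-1) -sI -lead_coefE lead_coef_eq0.
have TN : T`_N = mu0 by rewrite coefXM.
have AN : A`_N = c1 * mu0.
  rewrite EA coefD !coefZ TN [I`_N]nth_default ?mulr0 ?addr0 //.
  by rewrite sI.
have AN1 : A`_(m + n) = c1 * mu1 + c0 * mu0 by rewrite EA coefD !coefZ.
have BN1 : B`_N.+1 = g * (c1 * mu0) - al * mu0.
  by rewrite EB coefXM /= coefB !coefZ AN TN.
have BN : B`_N = g * (c1 * mu1 + c0 * mu0) - al * mu1.
  by rewrite EB coefXM /= coefB !coefZ AN1.
have den : (m.+1)%:R * e%:R + (n.+1)%:R * d%:R != 0 :> rat.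
  by rewrite -!natrM -natrD Num.Theory.pnatr_eq0 -lt0n addn_gt0 muln_gt0 e_gt0.
have c1n : c1 != 0.
  rewrite /c1; apply/negP => /eqP E; case/negP: den; apply/eqP.
  transitivity (d%:R * e%:R * c1); last by rewrite /c1 E mulr0.
  by rewrite /c1; field; rewrite dQ eQ.
split=> //; first by rewrite AN mulf_neq0.
rewrite AN BN BN1 [N.-1]/= AN1.
transitivity (- (2 * al * c0 / c1 ^+ 2)).
  by field; rewrite mu0n c1n.
have E1 : c1 = ((m.+1)%:R * e%:R + (n.+1)%:R * d%:R) / (d%:R * e%:R).
  by rewrite /c1; field; rewrite dQ eQ.
rewrite E1 /c0 !natrM; move: dQ eQ den.
move: (m.+1)%:R (n.+1)%:R d%:R e%:R => M1 N1 D1 F1 D0 F0 den; field.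
by rewrite den D0 F0.
Qed.

End DonaldsonFutaki.
End HilbertPolynomial.

Theorem theorem2 (K : closedFieldType) (charK : [pchar K] =i pred0)
    (m n : nat) (hm : (1 <= m)%N) (hn : (1 <= n)%N)
    (f : {mpoly K[m.+1 + n.+1]}) (hf : bihomog 1 1 f)
    (hX : normal_hypersurface f)
    (lam : one_ps K m n) (hlam : preserves lam f)
    (alpha : int) (halpha : has_weight lam f alpha)
    (d e : nat) (hd : (0 < d)%N) (he : (0 < e)%N)
    (r : nat) (hr : (0 < r)%N)
    (phi : K -> 'cV[K]_m.+1 -> 'cV[K]_n.+1 -> K) (hphi : linearization f lam phi) :
  DF_is (product_family f lam d e r phi)
    (- ((2 * m%:R * n%:R * d%:R * e%:R) / (m%:R * e%:R + n%:R * d%:R) ^+ 2)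
       * alpha%:~R).
Proof.
case: m hm f hf hX lam hlam halpha phi hphi => // m _.
case: n hn => // n _ f hf [prf _] lam hlam halpha phi hphi.
have [E [F [p [q [C [[Eu Fu] [p0 q0] [HE HF] pq [C0 frame]]]]]]] := weight_frame hf prf halpha.
have [c Hc] := linearization_character charK hf Eu Fu C0 frame hlam hphi.
(* A twist of weight c on the r-th power shifts every weight on the k-th power by c k / r, which
   adds (c / r) k N_k to w_k. *)
have [sA sB A0 DF] := donaldson_futaki_coefs m n hd he (c%:~R / r%:R) alpha%:~R.
exists r, (hilbert_poly m n d e),
  ((c%:~R / r%:R) *: ('X * hilbert_poly m n d e) - alpha%:~R *: ('X^2 * ideal_poly m n d e)).
have -> : fam_reldim (product_family f lam d e r phi) = (m + n).+1 by rewrite /=; lia.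
split=> //= k k0 rk.
set L := normal_monos m.+1 n.+1 (d * k) (e * k).
have dk : (d * k = (d * k).-1.+1)%N by rewrite prednK // muln_gt0 hd.
have ek : (e * k = (e * k).-1.+1)%N by rewrite prednK // muln_gt0 he.
pose wt (l : 'X_{1..m.+2} * 'X_{1..n.+2}) : int :=
  c * (k %/ r)%N%:Z - (\sum_i p i * (l.1 i)%:Z + \sum_j q j * (l.2 j)%:Z).
pose s (i : 'I_(size L)) (P : point K m.+1 n.+1) : K :=
  bimono (tnth (in_tuple L) i) (E *m px P) (F *m py P).
have bas : basis_on (central_fiber (product_family f lam d e r phi))
    (H0_central (product_family f lam d e r phi) k) s.
  exact: (normal_monos_basis charK hf Eu Fu C0 frame (d * k) (e * k) (t := 0)).
have sizeL : (size L)%:R = (hilbert_poly m n d e).[k%:R].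
  have := size_normal_monos m.+1 n.+1 (d * k).-1 (e * k).-1.
  rewrite -dk -ek -/L => /(congr1 (intr : int -> rat)).
  by rewrite rmorphB /= !rmorph_nat hilbert_polyE.
exists (size L), (\sum_(l <- L) wt l); split=> //.
- by exists s.
- exists (size L), s, (fun i => wt (tnth (in_tuple L) i)); split=> //;
    last by rewrite [LHS]big_tnth.
  move=> i t t0 P [Hx tau0]; rewrite /dual_act /= Hc // /s /=.
  have /= -> := basis_fun_weight (tnth (in_tuple L) i) P HE HF t0.
  by rewrite /wt expfzDr // -exprz_exp -exprnP mulrA.
rewrite big_split /= sumr_const_seq sumrN /L dk ek total_weight_normal_monos // -dk -ek -/L.
rewrite pq opprK hornerD hornerN 2!hornerZ (hornerM 'X) (hornerM 'X^2) hornerX hornerXn -sizeL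
  -ideal_polyE //.
rewrite rmorphB !rmorphM /= !rmorph_nat; congr (_ - _).
have rQ : r%:R != 0 :> rat by rewrite Num.Theory.pnatr_eq0 -lt0n.
by rewrite -{2}(divnK rk) natrM pmulrn; field.
Qed.
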